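(* Let $\{(T^{(n)}(\mathcal V),\mathcal G_n,\mathcal P_n)\}_{n\ge0}$ be a consistent family of triples as described in the context, and let $p\ge1$ be a real number, $[p]$ its integer part. Let $g\in C^{p-var}([0,T],\mathcal T_{[p]})$ and let $n\ge[p]+1$ be an integer. Then there exists a unique $g^n\in C^{p-var}([0,T],\mathcal T_n)$ satisfying $g^n_0=1\in\mathcal T_n$ and $1_{[p]}(g^n_t)=g_{0,t}$ for all $t\in[0,T]$. Moreover, there exists $\beta\in C([0,T],B(\mathcal T_{[p]},\mathcal T_n))$ such that $\beta$ and $g$ satisfy the integrable condition and $$g^n_t=\int_0^t\beta_u(g_u)\,dg_u,\qquad\forall t\in[0,T].$$ There exists a constant $C_{n,p}$, depending only on $n$ and $p$, such that $$\|g^n\|_{p-var,[s,t]}\le C_{n,p}\|g\|_{p-var,[s,t]},\qquad\forall\,0\le s\le t\le T.$$ If in addition $g$ takes values in $\mathcal G_{[p]}$ and the following condition holds: for every integer $m\ge1$ there is a constant $C_m>0$ such that for every $a\in\mathcal G_m$ there exists $\widetilde a\in\mathcal G_{m+1}$ with $1_m(\widetilde a)=a$ and $|\widetilde a|\le C_m|a|$; then $g^n$ takes values in $\mathcal G_n$.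
   Context: **Groups and cocyclic one-forms.** A topological group in a Banach algebra $\mathcal A$ is a subset $\mathcal G\subseteq\mathcal A$ which is a topological group for the unit, multiplication and topology of $\mathcal A$. $L(\mathcal A,\mathcal B)$ is the space of continuous linear maps with the operator norm. For $\beta\in C(\mathcal G,L(\mathcal A,\mathcal B))$ (continuous maps) write $\beta(a,v):=\beta(a)(v)$. If $\mathcal G,\mathcal K$ are topological groups in $\mathcal A,\mathcal B$, then $B(\mathcal G,\mathcal K)$ is the set of cocyclic one-forms: those $\beta\in C(\mathcal G,L(\mathcal A,\mathcal B))$ with $\beta(a,b)\in\mathcal K$ and $\beta(a,b)\beta(ab,c)=\beta(a,bc)$ for all $a,b,c\in\mathcal G$. $\beta\in C([0,T],B(\mathcal G,\mathcal K))$ means that $\beta_t\in B(\mathcal G,\mathcal K)$ for every $t$ and $t\mapsto\beta_t(a,\cdot)\in L(\mathcal A,\mathcal B)$ is continuous for every $a\in\mathcal G$. **A triple $(T^{(n)}(\mathcal V),\mathcal G_n,\mathcal P_n)$.** $\mathcal V$ is a Banach space whose tensor powers carry admissible norms: $\|\varrho v\|=\|v\|$ for $v\in\mathcal V^{\otimes k}$ and $\varrho$ in the symmetric group of degree $k$, and $\|u\otimes v\|=\|u\|\|v\|$ for $u\in\mathcal V^{\otimes k},v\in\mathcal V^{\otimes j}$. (1) $T^{(n)}(\mathcal V)$ is a unital associative Banach algebra which as a Banach space equals $\mathbb R\oplus\mathcal V\oplus\dots\oplus\mathcal V^{\otimes n}$ with norm $\|v\|=\sum_{k=0}^n\|\pi_k(v)\|$,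 $\pi_k$ being the projection to $\mathcal V^{\otimes k}$. (2) $\mathcal P_n$ is a finite set of continuous linear maps $\sigma\in L(T^{(n)}(\mathcal V),\mathcal V^{\otimes|\sigma|})$, $|\sigma|\in\{0,\dots,n\}$, such that: the projection $\sigma_0$ onto $\mathbb R$ is in $\mathcal P_n$; $\sigma\circ\sigma=\sigma$ and $a=\sum_{\sigma\in\mathcal P_n}\sigma(a)$ for all $a$; there is a comultiplication $\triangle$ with $\triangle\sigma_0=\sigma_0\otimes\sigma_0$ and, for $|\sigma|\ge1$, $\triangle\sigma=\sigma\otimes\sigma_0+\sigma_0\otimes\sigma+\sum_{i=1}^{N(\sigma)}\sigma^{1,i}\otimes\sigma^{2,i}$ with $\sigma^{j,i}\in\mathcal P_n$, $|\sigma^{j,i}|\ge1$, $|\sigma^{1,i}|+|\sigma^{2,i}|=|\sigma|$ (and $N(\sigma)=0$ if $|\sigma|=1$); and $\sigma_0(ab)=\sigma_0(a)\sigma_0(b)$ and, for $|\sigma|\ge1$, $\sigma(ab)=\sigma(a)\sigma_0(b)+\sigma_0(a)\sigma(b)+\sum_{i}\sigma^{1,i}(a)\otimes\sigma^{2,i}(b)$. (3) $\mathcal G_n$ is a closed connected topological group in $T^{(n)}(\mathcal V)$ with $\sigma_0(a)=1$ for all $a\in\mathcal G_n$. **Consistent family.** For $m\ge n\ge1$: $\mathcal P_n=\{\sigma\in\mathcal P_m:|\sigma|\le n\}$, and the map $1_n:T^{(m)}(\mathcal V)\to T^{(n)}(\mathcal V)$, $1_n(a)=\sum_{\sigma\in\mathcal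 P_n}\sigma(a)$, is an algebra homomorphism which induces a group homomorphism $\mathcal G_m\to\mathcal G_n$ with $1_n(\mathcal G_m)=\mathcal G_n$. **The group $\mathcal T_n$ and $p$-variation.** $\mathcal T_n:=\{a\in T^{(n)}(\mathcal V):\sigma_0(a)=1\}$, a closed topological group in $T^{(n)}(\mathcal V)$ containing $\mathcal G_n$. For $a\in\mathcal T_n$, $|a|:=\sum_{\sigma\in\mathcal P_n,|\sigma|\ge1}\|\sigma(a)\|^{1/|\sigma|}$. For a path $g$ in $\mathcal T_n$, $g_{s,t}:=g_s^{-1}g_t$ and $\|g\|_{p-var,[s,t]}:=\sup_D\big(\sum_{t_k\in D}|g_{t_k,t_{k+1}}|^p\big)^{1/p}$ over finite partitions $D$ of $[s,t]$. $C^{p-var}([0,T],\mathcal T_n)$ is the set of continuous paths with $\|g\|_{p-var,[0,T]}<\infty$. **Integral and integrable condition.** For $s<t$, $\int_s^t\beta_u(g_u)\,dg_u:=\lim_{|D|\to0}\beta_{t_0}(g_{t_0},g_{t_0,t_1})\cdots\beta_{t_{l-1}}(g_{t_{l-1}},g_{t_{l-1},t_l})$ over finite partitions $D=\{s=t_0<\dots<t_l=t\}$, provided the limit exists. $\beta\in C([0,T],B(\mathcal T_{[p]},\mathcal T_n))$ and $g$ satisfy the integrable condition if there are $M>0$, $\theta>1$ and a control $\omega$ (a continuous function $\{0\le s\le t\le T\}\to[0,\infty)$, zero on the diagonal, with $\omega(s,u)+\omega(u,t)\le\omega(s,t)$) such that $\|\sigma(\beta_s(g_s,g_{s,t}))\|\le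 M$ for all $s<t$ and $\|\sigma((\beta_u-\beta_s)(g_u,g_{u,t}))\|\le\omega(s,t)^\theta$ for all $s<u<t$ and all $\sigma\in\mathcal P_n$.
   Formalization: Each map σ in P_n is assumed to vanish on the tensor powers of degree other than |σ| (automatic in finite dimension; otherwise the claim can fail), and the constant C_{n,p} may depend on the fixed family of triples, but not on T, g, s, t. *)

(* Defs.v *)
From HB Require Import structures.
From mathcomp Require Import all_boot all_order all_algebra all_fingroup.
From mathcomp Require Import all_classical all_reals all_analysis.

Set Implicit Arguments.
Unset Strict Implicit.
Unset Printing Implicit Defensive.

Import Order.TTheory GRing.Theory Num.Theory.
Import numFieldNormedType.Exports.
Local Open Scope classical_set_scope.
Local Open Scope ring_scope.

Record banach_algebra (R : realType) := BanachAlgebra {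
  ba_space : completeNormedModType R;
  ba_one : ba_space;
  ba_mul : ba_space -> ba_space -> ba_space;
  ba_mulA : associative ba_mul;
  ba_mul1l : left_id ba_one ba_mul;
  ba_mul1r : right_id ba_one ba_mul;
  ba_mulDl : left_distributive ba_mul +%R;
  ba_mulDr : right_distributive ba_mul +%R;
  ba_scaleAl : forall (c : R) x y, c *: ba_mul x y = ba_mul (c *: x) y;
  ba_scaleAr : forall (c : R) x y, c *: ba_mul x y = ba_mul x (c *: y);
  ba_one_neq0 : ba_one != 0;
  ba_normM : forall x y, `|ba_mul x y| <= `|x| * `|y|
}.

Definition ba_sort (R : realType) (A : banach_algebra R) : Type := ba_space A.
Coercion ba_sort : banach_algebra >-> Sortclass.

Section BanachAlgebraStructure.
Context {R : realType} (A : banach_algebra R).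

HB.instance Definition _ := CompleteNormedModule.copy (ba_sort A) (ba_space A).

HB.instance Definition _ := GRing.Zmodule_isNzRing.Build (ba_sort A)
  (@ba_mulA R A) (@ba_mul1l R A) (@ba_mul1r R A) (@ba_mulDl R A)
  (@ba_mulDr R A) (@ba_one_neq0 R A).

HB.instance Definition _ :=
  GRing.Lmodule_isLalgebra.Build R (ba_sort A) (@ba_scaleAl R A).

HB.instance Definition _ :=
  GRing.Lalgebra_isAlgebra.Build R (ba_sort A) (@ba_scaleAr R A).

Definition ba_is_inverse (x y : A) : Prop := y * x = 1 /\ x * y = 1.

Definition ba_unit : pred A := fun x => `[< exists y, ba_is_inverse x y >].

(* For non-invertible elements the inverse is junk. *)
Definition ba_inv (x : A) : A := xget x (ba_is_inverse x).

Lemma ba_invP x : x \in ba_unit -> ba_is_inverse x (ba_inv x).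
Proof. by move=> /asboolP [y xy]; apply: (xgetPex x); exists y. Qed.

Lemma ba_mulVx : {in ba_unit, left_inverse 1 ba_inv *%R}.
Proof. by move=> x xU; exact: (proj1 (ba_invP xU)). Qed.

Lemma ba_mulxV : {in ba_unit, right_inverse 1 ba_inv *%R}.
Proof. by move=> x xU; exact: (proj2 (ba_invP xU)). Qed.

Lemma ba_unitPx (x y : A) : y * x = 1 /\ x * y = 1 -> x \in ba_unit.
Proof. by move=> xy; apply/asboolP; exists y. Qed.

Lemma ba_invx_out : {in [predC ba_unit], ba_inv =1 id}.
Proof.
by move=> x /asboolPn xNu; apply: xgetPN => y xy; apply: xNu; exists y.
Qed.

HB.instance Definition _ := GRing.NzRing_hasMulInverse.Build (ba_sort A)
  ba_mulVx ba_mulxV ba_unitPx ba_invx_out.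

End BanachAlgebraStructure.

Record is_topological_group (R : realType) (A : banach_algebra R)
    (G : set A) : Prop := {
  topgrp1 : G 1;
  topgrpM : forall a b, G a -> G b -> G (a * b);
  topgrp_unit : forall a, G a -> a \is a GRing.unit;
  topgrpV : forall a, G a -> G a^-1;
  topgrpM_continuous :
    {within G `*` G, continuous (fun x : A * A => x.1 * x.2)};
  topgrpV_continuous : {within G, continuous (fun a : A => a^-1)}
}.

Record clin (R : realType) (A B : normedModType R) := Clin {
  clin_fun :> {linear A -> B};
  clin_continuous : continuous clin_fun
}.

Definition opnorm (R : realType) (A B : normedModType R) (f : A -> B) : R :=
  sup [set `|f v| | v in [set v : A | `|v| <= 1]].

Section OneForms.
Context {R : realType} {A B : banach_algebra R}.

(* A one-form on [G] is a map defined on all of [A] of which only the values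
   on [G] are ever used; likewise time-dependent one-forms are defined on [R]
   and used on [0, T]. *)
Definition cocyclic (G : set A) (K : set B) (beta : A -> clin A B) : Prop :=
  [/\ forall a, G a ->
        (fun b => opnorm (beta b \- beta a)) @ within G (nbhs a) --> (0 : R),
      forall a b, G a -> G b -> K (beta a b) &
      forall a b c, G a -> G b -> G c ->
        beta a b * beta (a * b) c = beta a (b * c)].

Definition cocyclic_path (T : R) (G : set A) (K : set B)
    (beta : R -> A -> clin A B) : Prop :=
  (forall t, 0 <= t <= T -> cocyclic G K (beta t)) /\
  (forall a, G a -> forall t, 0 <= t <= T ->
     (fun u => opnorm (beta u a \- beta t a)) @ within `[0, T] (nbhs t)
       --> (0 : R)).

Definition incr (X : unitRingType) (g : R -> X) (s t : R) : X := (g s)^-1 * g t.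

(* As in the library, [D] lists the points of a partition of [s, t] other than
   [s]; for [s = t] the only partition is [[::]], so that the integral over a
   point is the empty product [1]. *)
Definition one_form_prod (beta : R -> A -> clin A B) (g : R -> A) (s t : R)
    (D : seq R) : B :=
  \prod_(0 <= i < size D)
     let u := nth t (s :: D) i in let v := nth t (s :: D) i.+1 in
     beta u (g u) (incr g u v).

Definition is_one_form_integral (beta : R -> A -> clin A B) (g : R -> A)
    (s t : R) (I : B) : Prop :=
  forall e : R, 0 < e -> exists2 d : R, 0 < d &
    forall D, itv_partition s t D ->
      (forall i, (i < size D)%N ->
         nth t (s :: D) i.+1 - nth t (s :: D) i < d) ->
      `|one_form_prod beta g s t D - I| < e.

End OneForms.

Definition is_control (R : realType) (T : R) (w : R -> R -> R) : Prop :=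
  [/\ {within [set x : R * R | 0 <= x.1 <= x.2 /\ x.2 <= T],
         continuous (fun x : R * R => w x.1 x.2)},
      forall s t, 0 <= s <= t -> t <= T -> 0 <= w s t,
      forall t, 0 <= t <= T -> w t t = 0 &
      forall s u t, 0 <= s <= u -> u <= t <= T -> w s u + w u t <= w s t].

Section TensorPowers.
Context {R : realType} (V : completeNormedModType R).

Definition tuple_set (X : Type) k (v : k.-tuple X) (i : 'I_k) (x : X) :
    k.-tuple X :=
  [tuple if j == i then x else tnth v j | j < k].

Definition multilinear (X : lmodType R) k (f : k.-tuple V -> X) : Prop :=
  forall v i (c : R) x y,
    f (tuple_set v i (c *: x + y))
    = c *: f (tuple_set v i x) + f (tuple_set v i y).

Definition tensor_space (high : nat -> completeNormedModType R) (k : nat) :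
    completeNormedModType R :=
  match k with
  | 0 => R^o
  | 1 => V
  | k'.+2 => high k'
  end.

(* The tensor powers of [V], completed for admissible norms:
   [tens_universal] says that the span of the elementary tensors is the
   algebraic tensor power (every multilinear map factors through a linear map
   on that span), [tens_dense] that the Banach space is its completion. *)
Record tensor_powers := TensorPowers {
  tens_high : nat -> completeNormedModType R;
  tpow := tensor_space tens_high;
  tens : forall k, k.-tuple V -> tpow k;
  tmul : forall i j, tpow i -> tpow j -> tpow (i + j);
  tens0 : forall v : 0.-tuple V, tens v = (1 : R^o);
  tens1 : forall v : V, tens [tuple v] = v;
  tens_multilinear : forall k, multilinear (@tens k);
  tens_universal : forall k (X : lmodType R) (f : k.-tuple V -> X),
    multilinear f -> exists L : tpow k -> X,
      forall N (c : 'I_N -> R) (v : 'I_N -> k.-tuple V),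
        L (\sum_(i < N) c i *: tens (v i)) = \sum_(i < N) c i *: f (v i);
  tens_dense : forall k,
    dense [set w : tpow k |
      exists N (c : 'I_N -> R) (v : 'I_N -> k.-tuple V),
        w = \sum_(i < N) c i *: tens (v i)];
  tmul_linearl : forall i j (w : tpow j), linear (fun u : tpow i => tmul u w);
  tmul_linearr : forall i j (u : tpow i), linear (fun w : tpow j => tmul u w);
  tmul_tens : forall i j (u : i.-tuple V) (v : j.-tuple V),
    tmul (tens u) (tens v) = tens [tuple of u ++ v];
  norm_tmul : forall i j (u : tpow i) (w : tpow j),
    `|tmul u w| = `|u| * `|w|;
  norm_tperm : forall k (s : 'S_k), exists f : {linear tpow k -> tpow k},
    (forall v : k.-tuple V, f (tens v) = tens [tuple tnth v (s i) | i < k])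
    /\ (forall w, `|f w| = `|w|)
}.

End TensorPowers.

Arguments tpow {R V} t k : simpl never.
Arguments tmul {R V t i j} u w.

Section Triples.
Context {R : realType} {V : completeNormedModType R} (W : tensor_powers V).
Context {S : eqType} (deg : S -> nat).

(* The maps sigma are named by symbols of [S], [deg s] being [|s|], so that
   the same sigma can act on several of the algebras.  The algebra is the
   internal direct sum of the [tpow W k], [k <= n], through the injections
   [inj] and the projections [proj] (which are irrelevant for [k > n]);
   equations between elements of the tensor powers are stated after [inj],
   which avoids transporting along equalities between degrees. *)
Record triple (n : nat) := Triple {
  talg :> banach_algebra R;
  inj : forall k, {linear tpow W k -> talg};
  proj : forall k, {linear talg -> tpow W k};
  injK : forall k (w : tpow W k), (k <= n)%N -> proj k (inj k w) = w;
  proj_inj : forall j k (w : tpow W k), (j <= n)%N -> (k <= n)%N -> j != k ->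
    proj j (inj k w) = 0;
  talg_sum : forall a : talg, a = \sum_(k < n.+1) inj k (proj k a);
  talg_norm : forall a : talg, `|a| = \sum_(k < n.+1) `|proj k a|;

  symb : seq S;
  act : forall s, clin talg (tpow W (deg s));
  symb_uniq : uniq symb;
  symb_deg : forall s, s \in symb -> (deg s <= n)%N;
  act_inj : forall s t, s \in symb -> t \in symb -> deg s = deg t ->
    (forall a, inj _ (act s a) = inj _ (act t a)) -> s = t;
  act_idem : forall s, s \in symb -> forall a,
    act s (inj _ (act s a)) = act s a;
  (* sigma lives in degree [|sigma|].  In finite dimension this follows from
     [act_idem] and [act_sum]; in infinite dimension it does not, since
     idempotents summing to the identity need not be orthogonal. *)
  act_graded : forall s, s \in symb -> forall k (w : tpow W k),
    (k <= n)%N -> k != deg s -> act s (inj k w) = 0;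
  act_sum : forall a, a = \sum_(s <- symb) inj _ (act s a);

  s0 : S;
  s0_symb : s0 \in symb;
  s0_deg : deg s0 = 0%N;
  act_s0 : forall a, inj _ (act s0 a) = inj 0 (proj 0 a);

  (* The pairs (sigma^{1,i}, sigma^{2,i}) of the comultiplication: for
     [|s| >= 1], the coproduct of [s] is (s, s0) + (s0, s) + [redcop s]. *)
  redcop : S -> seq (S * S);
  redcopP : forall s, s \in symb -> (1 <= deg s)%N ->
    forall x, x \in redcop s ->
      [/\ x.1 \in symb, x.2 \in symb, (1 <= deg x.1)%N, (1 <= deg x.2)%N &
          (deg x.1 + deg x.2)%N = deg s];
  proj0M : forall a b : talg,
    proj 0 (a * b) = (proj 0 a : R^o) * (proj 0 b : R^o);
  actM : forall s, s \in symb -> (1 <= deg s)%N -> forall a b : talg,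
    inj _ (act s (a * b))
    = (proj 0 b : R) *: inj _ (act s a) + (proj 0 a : R) *: inj _ (act s b)
      + \sum_(x <- redcop s) inj _ (tmul (act x.1 a) (act x.2 b));

  tgrp : set talg;
  tgrp_group : is_topological_group tgrp;
  tgrp_closed : closed tgrp;
  tgrp_connected : connected tgrp;
  tgrp_proj0 : forall a, tgrp a -> proj 0 a = (1 : R^o)
}.

Arguments tgrp {n} _.

Definition trunc m n (Y : triple m) (X : triple n) (a : Y) : X :=
  \sum_(s <- symb X) inj X _ (act Y s a).

Record consistent (F : forall n, triple n) : Prop := {
  consistent_symb : forall m n, (1 <= n <= m)%N ->
    forall s, (s \in symb (F n)) = (s \in symb (F m)) && (deg s <= n)%N;
  consistent_act : forall m n, (1 <= n <= m)%N ->
    forall s, s \in symb (F n) -> forall a : F m,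
      act (F n) s (trunc (F n) a) = act (F m) s a;
  consistent_linear : forall m n, (1 <= n <= m)%N ->
    linear (@trunc m n (F m) (F n));
  consistent_monoid_morphism : forall m n, (1 <= n <= m)%N ->
    monoid_morphism (@trunc m n (F m) (F n));
  consistent_tgrp : forall m n, (1 <= n <= m)%N ->
    trunc (F n) @` tgrp (F m) = tgrp (F n)
}.

Context {n : nat} (X : triple n).

Definition ugrp : set X := [set a | proj X 0 a = (1 : R^o)].

Definition hnorm (a : X) : R :=
  \sum_(s <- symb X | (1 <= deg s)%N) `|act X s a| `^ (deg s)%:R^-1.

Definition pvar (p : R) (g : R -> X) (s t : R) : \bar R :=
  ereal_sup [set ((\sum_(0 <= i < size D)
                     hnorm (incr g (nth t (s :: D) i) (nth t (s :: D) i.+1))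
                       `^ p) `^ p^-1)%:E
            | D in itv_partition s t].

Definition cpvar_path (p T : R) (g : R -> X) : Prop :=
  [/\ forall t, 0 <= t <= T -> ugrp (g t),
      {within `[0, T], continuous g} &
      (pvar p g 0 T < +oo)%E].

Definition integrable_condition (A : banach_algebra R) (T : R)
    (beta : R -> A -> clin A X) (g : R -> A) : Prop :=
  exists (M theta : R) (w : R -> R -> R),
    [/\ 0 < M, 1 < theta, is_control T w,
        forall sigma, sigma \in symb X ->
          forall s t, 0 <= s -> s < t -> t <= T ->
            `|act X sigma (beta s (g s) (incr g s t))| <= M &
        forall sigma, sigma \in symb X ->
          forall s u t, 0 <= s -> s < u -> u < t -> t <= T ->
            `|act X sigma
               (beta u (g u) (incr g u t) - beta s (g u) (incr g u t))|
            <= w s t `^ theta].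

End Triples.

Arguments tgrp {R V W S deg n} _.
Arguments ugrp {R V W S deg n} X.

(* Main.v *)
Require Import Defs.
From HB Require Import structures.
From mathcomp Require Import all_boot all_order all_algebra all_fingroup.
From mathcomp Require Import all_classical all_reals all_analysis.
From mathcomp Require Import ring lra zify.

(** Write [N = [p]] and [X], [Y] for the algebras of levels [n] and [N]. The
    algebra [X] is a graded Banach algebra: an element [a] has homogeneous
    components [gpart k a], its norm is the sum of their norms, and [gpartM]
    says that components multiply like those of a truncated tensor algebra.
    The elements with component [1] in degree [0] form a group, on which the
    inverse is a polynomial ([tinv]).

    Existence ([lift_exists]) goes one degree at a time. Let [w] be the
    superadditive function of intervals given by the [p]-th power of the
    p-variation of [g], and let [x] be a path whose increments [x_s^-1 x_t] have
    components of degree [k <= m] of size [w(s,t)^(k/p)]. Their component [Z(s,t)]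
    of degree [m + 1] is additive up to products of components of lower positive
    degree, hence up to a multiple of [w(s,t)^((m+1)/p)], an exponent larger than
    [1] as soon as [m >= N]. The sewing lemma ([sewing]) provides a path [I] with
    [I_t - I_s - Z(s,t)] of the same size, and subtracting the degree [m + 1]
    part of [I] from [x] gives the bound in degree [m + 1] as well ([level_step]).
    The induction starts from the embedding of [g_0^-1 g_t] into [X]. The bounds
    are homogeneous, so that the p-variation of the result is controlled on every
    interval by that of [g], with a constant that depends on the triples, [n] and
    [p] only.

    Everything else follows from one comparison ([product_approx], [lift_approx]):
    if [h] is a lift and [a_i] agrees with the increment of [h] over the [i]-th
    interval of a partition up to degree [N], and is of comparable size, then the
    two differ by [o(w_i)], where [w_i] is the value of a control of [h] on that
    interval, so that the ordered product of the [a_i] tends to [h]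
    as the mesh tends to [0]. Taking for [a_i] the embedded increments of [g] gives
    uniqueness, and the integral of the cocyclic one-form
    [beta_s(a, b) = e(g_s^-1 a)^-1 e(g_s^-1 a b)], where [e] is the embedding and for
    which [beta_s(g_s, .) = e]. Taking for [a_i] lifts of the increments to the
    closed group [tgrp X] shows that [h] takes its values in this group.

    Uniform smallness of [w] on short intervals, needed in both parts, is the
    continuity of the p-variation of a continuous path ([vsum_unif]). *)

Set Implicit Arguments.
Unset Strict Implicit.
Unset Printing Implicit Defensive.

Import Order.TTheory GRing.Theory Num.Theory.
Import numFieldNormedType.Exports.
Local Open Scope classical_set_scope.
Local Open Scope ring_scope.

Local Notation inj := Defs.inj.
Local Notation proj := Defs.proj.
Local Notation act := Defs.act.

(** * Linear identities in abelian groups *)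

(** Formal integral combinations of the elements of a list, used to decide by
    computation identities that hold in every abelian group. *)
Inductive zexpr :=
  ZVar of nat | ZAdd of zexpr & zexpr | ZOpp of zexpr | ZZero.

Fixpoint zval (E : zmodType) (env : seq E) (e : zexpr) : E :=
  match e with
  | ZVar i => env`_i
  | ZAdd e1 e2 => zval env e1 + zval env e2
  | ZOpp e1 => - zval env e1
  | ZZero => 0
  end.

Fixpoint zcoef (e : zexpr) (i : nat) : int :=
  match e with
  | ZVar j => Posz (i == j)
  | ZAdd e1 e2 => zcoef e1 i + zcoef e2 i
  | ZOpp e1 => - zcoef e1 i
  | ZZero => 0
  end.

Lemma zvalE (E : zmodType) (env : seq E) e :
  zval env e = \sum_(i < size env) env`_i *~ zcoef e i.
Proof.
elim: e => [j|e1 IH1 e2 IH2|e IH|] /=.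
- have [js|js] := ltnP j (size env).
    rewrite (bigD1 (Ordinal js))//= eqxx big1 ?addr0// => i ij.
    by rewrite (_ : (i == j :> nat) = false) ?mulr0z//; exact: negbTE.
  rewrite nth_default// big1// => i _.
  by rewrite ltn_eqF ?mulr0z// (leq_trans (ltn_ord i)).
- by rewrite IH1 IH2 -big_split; apply: eq_bigr => i _; rewrite mulrzDr.
- by rewrite IH -sumrN; apply: eq_bigr => i _; rewrite mulrNz.
- by rewrite big1// => i _; rewrite mulr0z.
Qed.

Lemma zval_eq (E : zmodType) (env : seq E) e1 e2 :
  all (fun i => zcoef e1 i == zcoef e2 i) (iota 0 (size env)) ->
  zval env e1 = zval env e2.
Proof.
move=> /allP e12; rewrite !zvalE; apply: eq_bigr => i _.
by rewrite (eqP (e12 _ _))// mem_iota add0n ltn_ord.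
Qed.

Ltac zhead t := lazymatch t with ?f _ => zhead f | _ => t end.

(** Two atoms are identified when they are convertible and have the same head
    symbol: ring operations may be reached through different structures. *)
Ltac zsame x y :=
  first [ constr_eq x y
        | let f := zhead x in let g := zhead y in constr_eq f g; unify x y ].

Ltac zindex x env :=
  match env with
  | ?y :: _ => let _ := match goal with _ => zsame x y end in constr:(0%N)
  | _ :: ?env' => let i := zindex x env' in constr:(i.+1)
  end.

Ltac zatoms env t :=
  lazymatch t with
  | @GRing.add _ ?a ?b => let env1 := zatoms env a in zatoms env1 b
  | @GRing.opp _ ?a => zatoms env a
  | @GRing.zero _ => env
  | ?x => match env with
          | _ => let i := zindex x env in env
          | _ => constr:(x :: env)
          end
  end.

Ltac zreify env t :=
  lazymatch t with
  | @GRing.add _ ?a ?b =>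
      let e1 := zreify env a in let e2 := zreify env b in constr:(ZAdd e1 e2)
  | @GRing.opp _ ?a => let e1 := zreify env a in constr:(ZOpp e1)
  | @GRing.zero _ => constr:(ZZero)
  | ?x => let i := zindex x env in constr:(ZVar i)
  end.

(** Closes an equation between integral combinations in an abelian group. *)
Ltac zmod :=
  lazymatch goal with
  | |- @eq ?T ?l ?r =>
      let env0 := zatoms (@nil T) l in
      let env := zatoms env0 r in
      let e1 := zreify env l in
      let e2 := zreify env r in
      exact (@zval_eq _ env e1 e2 isT)
  end.

(** * Sewing of almost additive two-parameter maps *)

Section Powers.
Context {R : realType}.

Lemma powR_mono (x y a : R) : 0 <= a -> 0 <= x -> x <= y -> x `^ a <= y `^ a.
Proof.
move=> a0 x0 xy; apply: ge0_ler_powR => //; rewrite ?nnegrE//.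
exact: le_trans xy.
Qed.

Lemma powR_half (x a : R) : 0 <= x -> (x / 2) `^ a = 2 `^ (- a) * x `^ a.
Proof. by move=> x0; rewrite powRM ?invr_ge0// -powR_inv1// -powRrM mulN1r mulrC. Qed.

(** A power larger than [1] is negligible against the identity near [0]. *)
Lemma powR_small (th eta : R) : 1 < th -> 0 < eta ->
  exists2 d : R, 0 < d & forall x, 0 <= x -> x < d -> x `^ th <= eta * x.
Proof.
move=> th1 e0; exists (eta `^ (th - 1)^-1); first exact: powR_gt0.
move=> x x0 xd; have th10 : 0 < th - 1 by rewrite subr_gt0.
rewrite -(mulr_powRB1 x0) ?(lt_trans ltr01)// mulrC ler_wpM2r//.
apply: (@le_trans _ _ ((eta `^ (th - 1)^-1) `^ (th - 1))).
  by apply: powR_mono => //; exact: ltW.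
by rewrite -powRrM mulVf ?gt_eqF// powRr1// ltW.
Qed.

Lemma expr_powR (x p : R) k : 0 <= x -> (x `^ p^-1) ^+ k = x `^ (k%:R / p).
Proof.
by move=> x0; rewrite -powR_mulrn ?powR_ge0// -powRrM mulrC.
Qed.

End Powers.

(** The constant of the sewing estimates: the solution [M] of
    [2 M 2^(-th) + 2 = M]. *)
Definition sew_const {R : realType} (th : R) : R := 2 / (1 - 2 `^ (1 - th)).

Section DiscreteSewing.
Context {R : realType} (th : R).
Hypothesis th1 : 1 < th.

Lemma two_powR_lt1 : 2 `^ (1 - th) < 1 :> R.
Proof.
have -> : 1 - th = - (th - 1) by rewrite opprB.
have p1 : 1 < 2 `^ (th - 1) :> R.
  rewrite -[X in X < _](powRr0 (2 : R)) /powR pnatr_eq0 /= ltr_expR.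
  rewrite mul0r mulr_gt0// ?subr_gt0//.
  by rewrite ln_gt0// ltr1n.
by rewrite powRN invf_lt1// (lt_trans ltr01).
Qed.

Lemma sew_const_gt0 : 0 < sew_const th.
Proof. by rewrite divr_gt0// subr_gt0 two_powR_lt1. Qed.

Lemma sew_const_ge1 : 1 <= sew_const th.
Proof.
have h : 0 < 1 - 2 `^ (1 - th) by rewrite subr_gt0 two_powR_lt1.
rewrite /sew_const ler_pdivlMr// mul1r.
have : 0 <= 2 `^ (1 - th) :> R by exact: powR_ge0.
lra.
Qed.

Lemma sew_constE : 2 * sew_const th * 2 `^ (- th) + 2 = sew_const th.
Proof.
have h : 0 < 1 - 2 `^ (1 - th) by rewrite subr_gt0 two_powR_lt1.
have e : 2 `^ (1 - th) = 2 * 2 `^ (- th) :> R.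
  by rewrite powRD ?powRr1// ?pnatr_eq0 ?implybT.
rewrite /sew_const e in h *.
by field; apply/lt0r_neq0.
Qed.

Context {E : normedModType R} (Z : nat -> nat -> E) (w : nat -> nat -> R)
  (K : R) (l : nat).
Hypothesis K0 : 0 <= K.
Hypothesis w0 : forall i j, (i <= j <= l)%N -> 0 <= w i j.
Hypothesis wD : forall i j k, (i <= j)%N -> (j <= k <= l)%N ->
  w i j + w j k <= w i k.
Hypothesis ZD : forall i j k, (i <= j)%N -> (j <= k <= l)%N ->
  `|Z i k - Z i j - Z j k| <= K * w i k `^ th.

(** Cutting the sum where [w] reaches half of its total leaves two pieces whose
    errors add up to [2 M (w / 2)^th], and [th > 1] leaves room in [M w^th] for the
    error [2 w^th] of the cut itself. *)
Lemma discrete_sewing a b : (a <= b <= l)%N ->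
  `|\sum_(a <= i < b) Z i i.+1 - Z a b| <= sew_const th * K * w a b `^ th.
Proof.
have th0 : 0 <= th by rewrite ltW// (lt_trans ltr01).
have M0 := sew_const_gt0.
have [d] := ubnP (b - a)%N; elim: d a b => // d IH a b.
rewrite ltnS => bad /andP[ab bl].
have K1 c : 0 <= c -> K * c <= sew_const th * K * c.
  by move=> c0; rewrite ler_wpM2r// ler_peMl// sew_const_ge1.
have wii i : (i <= l)%N -> w i i = 0.
  move=> il; have := @wD i i i (leqnn i); rewrite leqnn il => /(_ isT).
  by have := @w0 i i; rewrite leqnn il => /(_ isT); lra.
move: ab; rewrite leq_eqVlt => /orP[/eqP ab|ab].
  rewrite -{}ab in bad bl *; rewrite big_geq// sub0r normrN.
  have := @ZD a a a (leqnn a); rewrite leqnn bl => /(_ isT).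
  rewrite subrr sub0r normrN => /le_trans; apply; apply: K1; exact: powR_ge0.
(* cut at the first index J whose [w a J] exceeds half of [w a b] *)
pose Q j := (a < j)%N && ((j == b) || (w a b / 2 < w a j)).
have exQ : exists j, Q j by exists b; rewrite /Q ab eqxx.
case: (ex_minnP exQ) => J /andP[aJ QJ] minJ.
have Jb : (J <= b)%N by apply: minJ; rewrite /Q ab eqxx.
have wab0 : 0 <= w a b by apply: w0; rewrite ltnW.
set j := J.-1.
have Jj : J = j.+1 by rewrite /j (ltn_predK aJ).
have aj : (a <= j)%N by rewrite -ltnS -Jj.
have jb : (j < b)%N by rewrite -Jj.
have jl : (j <= l)%N by apply: leq_trans bl; exact: ltnW.
have Jl : (J <= l)%N by exact: leq_trans bl.
have waj : w a j <= w a b / 2.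
  move: aj; rewrite leq_eqVlt => /orP[/eqP <-|aj'].
    by rewrite wii ?divr_ge0// (leq_trans (ltnW ab)).
  rewrite leNgt; apply/negP => h.
  by have := minJ j; rewrite /Q aj' h orbT Jj ltnn => /(_ isT).
have wJb : w J b <= w a b / 2.
  case/orP: QJ => [/eqP ->|h]; first by rewrite wii// divr_ge0.
  have := @wD a J b (ltnW aJ); rewrite Jb bl => /(_ isT); lra.
have waJ : w a J <= w a b.
  have := @wD a J b (ltnW aJ); rewrite Jb bl => /(_ isT).
  have := @w0 J b; rewrite Jb bl => /(_ isT); lra.
have IH1 := IH a j; have IH2 := IH J b.
rewrite aj jl in IH1; rewrite Jb bl in IH2.
have {}IH1 := IH1 (leq_trans (ltn_sub2r ab jb) bad) isT.
have {}IH2 := IH2 (leq_trans (ltn_sub2l ab aJ) bad) isT.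
have D1 := @ZD a J b (ltnW aJ); rewrite Jb bl in D1; have {}D1 := D1 isT.
have D2 := @ZD a j J aj; rewrite Jl Jj leqnSn -Jj in D2; have {}D2 := D2 isT.
have wp x y : 0 <= x -> x <= y -> x `^ th <= y `^ th by exact: powR_mono.
have p1 : w a j `^ th <= 2 `^ (- th) * w a b `^ th.
  rewrite -powR_half//; apply: wp => //; apply: w0; rewrite aj//.
have p2 : w J b `^ th <= 2 `^ (- th) * w a b `^ th.
  by rewrite -powR_half//; apply: wp => //; apply: w0; rewrite Jb.
have p3 : w a J `^ th <= w a b `^ th.
  by apply: wp => //; apply: w0; rewrite (ltnW aJ).
have -> : \sum_(a <= i < b) Z i i.+1 - Z a b =
   (\sum_(a <= i < j) Z i i.+1 - Z a j) + (\sum_(J <= i < b) Z i i.+1 - Z J b)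
   - (Z a b - Z a J - Z J b) - (Z a J - Z a j - Z j J).
  rewrite (big_cat_nat _ (n := j))//=; last exact: ltnW.
  rewrite (big_ltn jb) -Jj.
  set A := \sum_(_ <= i < j) _; set B := \sum_(_ <= _ < _) _.
  zmod.
set A := \sum_(_ <= i < j) _ - _ in IH1 *; set B := \sum_(_ <= i < b) _ - _ in IH2 *.
set C := Z a b - _ - _ in D1 *; set D := Z a J - _ - _ in D2 *.
have -> : sew_const th * K * w a b `^ th =
   sew_const th * K * (2 `^ (- th) * w a b `^ th) +
   sew_const th * K * (2 `^ (- th) * w a b `^ th) + K * w a b `^ th + K * w a b `^ th.
  rewrite -[in LHS]sew_constE; ring.
apply: (le_trans (ler_normB _ _)); apply: lerD; last first.
  by apply: (le_trans D2); rewrite ler_wpM2l.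
apply: (le_trans (ler_normB _ _)); apply: lerD => //.
apply: (le_trans (ler_normD _ _)); apply: lerD.
  by apply: (le_trans IH1); rewrite ler_wpM2l// mulr_ge0// ltW.
by apply: (le_trans IH2); rewrite ler_wpM2l// mulr_ge0// ltW.
Qed.

End DiscreteSewing.

Section Sewing.
Context {R : realType} {E : completeNormedModType R} (th K T : R)
  (Z : R -> R -> E) (w : R -> R -> R).
Hypothesis th1 : 1 < th.
Hypothesis K0 : 0 <= K.
Hypothesis T0 : 0 <= T.
Hypothesis w0 : forall s t, 0 <= s -> s <= t -> t <= T -> 0 <= w s t.
Hypothesis wD : forall s u t, 0 <= s -> s <= u -> u <= t -> t <= T ->
  w s u + w u t <= w s t.
Hypothesis wsmall : forall e, 0 < e -> exists2 d, 0 < d &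
  forall s t, 0 <= s -> s <= t -> t <= T -> t - s < d -> w s t < e.
Hypothesis ZD : forall s u t, 0 <= s -> s <= u -> u <= t -> t <= T ->
  `|Z s t - Z s u - Z u t| <= K * w s t `^ th.

Let thp : 0 < th := lt_trans ltr01 th1.

Lemma superadd_diag t : 0 <= t -> t <= T -> w t t = 0.
Proof.
by move=> t0 tT; have := wD t0 (lexx t) (lexx t) tT; have := w0 t0 (lexx t) tT; lra.
Qed.

Lemma almost_additive_diag t : 0 <= t -> t <= T -> Z t t = 0.
Proof.
move=> t0 tT; have := ZD t0 (lexx t) (lexx t) tT.
rewrite superadd_diag// powR0 ?gt_eqF// mulr0 subrr sub0r normrN normr_le0.
by move=> /eqP.
Qed.

Lemma superadd_sum (tau : nat -> R) l :
  {homo tau : i j / (i <= j)%N >-> i <= j} -> 0 <= tau 0%N -> tau l <= T ->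
  \sum_(0 <= j < l) w (tau j) (tau j.+1) <= w (tau 0%N) (tau l).
Proof.
move=> tm t0; elim: l => [|l IH] tl.
  by rewrite big_geq// superadd_diag.
rewrite big_nat_recr//=; have tl' : tau l <= T by apply: le_trans tl; exact: tm.
apply: le_trans (wD t0 (tm _ _ (leq0n l)) (tm _ _ (leqnSn l)) tl).
by rewrite lerD2r IH.
Qed.

Lemma partition_sewing (tau : nat -> R) a b :
  {homo tau : i j / (i <= j)%N >-> i <= j} -> 0 <= tau 0%N -> tau b <= T ->
  (a <= b)%N ->
  `|\sum_(a <= i < b) Z (tau i) (tau i.+1) - Z (tau a) (tau b)|
    <= sew_const th * K * w (tau a) (tau b) `^ th.
Proof.
move=> tm t0 tb ab.
have tge i : 0 <= tau i by rewrite (le_trans t0)// tm.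
have tle i : (i <= b)%N -> tau i <= T by move=> ib; rewrite (le_trans _ tb)// tm.
apply: (@discrete_sewing R th th1 E (fun i j => Z (tau i) (tau j))
  (fun i j => w (tau i) (tau j)) K b K0); rewrite ?ab ?leqnn//.
- by move=> i j /andP[ij jb]; apply: w0; rewrite ?tle ?tm.
- by move=> i j k ij /andP[jk kb]; apply: wD; rewrite ?tle ?tm.
- by move=> i j k ij /andP[jk kb]; apply: ZD; rewrite ?tle ?tm.
Qed.

(** Comparison of a partition sum with the sum over a coarser partition, whose
    points are selected by [kap]. *)
Lemma refinement_sewing (tau : nat -> R) (kap : nat -> nat) l eta :
  {homo tau : i j / (i <= j)%N >-> i <= j} -> 0 <= tau 0%N ->
  {homo kap : i j / (i <= j)%N >-> (i <= j)%N} -> tau (kap l) <= T ->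
  kap 0%N = 0%N ->
  (forall j, (j < l)%N -> w (tau (kap j)) (tau (kap j.+1)) `^ th <=
     eta * w (tau (kap j)) (tau (kap j.+1))) ->
  `|\sum_(0 <= i < kap l) Z (tau i) (tau i.+1) -
    \sum_(0 <= j < l) Z (tau (kap j)) (tau (kap j.+1))|
   <= sew_const th * K * (eta * \sum_(0 <= j < l) w (tau (kap j)) (tau (kap j.+1))).
Proof.
move=> tm t0 km + k0; elim: l => [|l IH] tl H.
  by rewrite k0 !big_geq// subrr normr0 !mulr0.
rewrite (big_cat_nat _ (n := kap l))//=; last exact: km.
rewrite (big_nat_recr l)//= [X in eta * X](big_nat_recr l)//= !mulrDr.
set A := \sum_(0 <= _ < _) _; set B := \sum_(_ <= _ < _) _.
set C := \sum_(_ <= _ < _) _.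
have -> : A + B - (C + Z (tau (kap l)) (tau (kap l.+1))) =
  (A - C) + (B - Z (tau (kap l)) (tau (kap l.+1))) by zmod.
apply: (le_trans (ler_normD _ _)); apply: lerD.
  apply: IH => [|j jl]; first by apply: le_trans tl; apply: tm; exact: km.
  by apply: H; rewrite ltnS ltnW.
apply: (le_trans (partition_sewing tm t0 tl _)); first exact: km.
by rewrite ler_wpM2l ?H// mulr_ge0// ltW// sew_const_gt0.
Qed.

(** Dyadic points of [0, T], clipped at [t], and the sums over them. *)
Let dy k i : R := T * i%:R / (2 ^ k)%:R.
Let clip k i t : R := Num.min (dy k i) t.
Let S k t : E := \sum_(0 <= i < 2 ^ k) Z (clip k i t) (clip k i.+1 t).

Let pow2 k : 0 < (2 ^ k)%:R :> R.
Proof. by rewrite ltr0n expn_gt0. Qed.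

Let dy_homo k : {homo dy k : i j / (i <= j)%N >-> i <= j}.
Proof.
move=> i j ij; rewrite /dy ler_pM2r ?invr_gt0//.
by rewrite ler_wpM2l// ler_nat.
Qed.

Let dy0 k : dy k 0 = 0. Proof. by rewrite /dy mulr0 mul0r. Qed.

Let dyT k : dy k (2 ^ k) = T.
Proof. by rewrite /dy mulfK// gt_eqF. Qed.

Let clip_homo k t : {homo clip k ^~ t : i j / (i <= j)%N >-> i <= j}.
Proof. by move=> i j /(dy_homo k) ij; rewrite /clip le_min !ge_min ij lexx !orbT. Qed.

Let clip0 k t : 0 <= t -> clip k 0 t = 0.
Proof. by move=> t0; rewrite /clip dy0 min_l. Qed.

Let clipT k t : t <= T -> clip k (2 ^ k) t = t.
Proof. by move=> tT; rewrite /clip dyT min_r. Qed.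

Let cells_small eta : 0 < eta -> exists k0, forall k, (k0 <= k)%N ->
  forall t i, 0 <= t -> t <= T ->
    w (clip k i t) (clip k i.+1 t) `^ th <= eta * w (clip k i t) (clip k i.+1 t).
Proof.
move=> /(powR_small th1)[d d0 dP]; have [d' d'0 d'P] := wsmall d0.
pose m := Num.truncn (T / d'); exists m => k mk t i t0 tT.
have c0 : 0 <= clip k i t by rewrite -(@clip0 k t t0); exact: clip_homo.
have cT : clip k i.+1 t <= T by rewrite (le_trans _ tT)// /clip ge_min lexx orbT.
have cc : clip k i t <= clip k i.+1 t by exact: clip_homo.
apply: dP; first exact: w0.
apply: d'P => //.
have : clip k i.+1 t - clip k i t <= T / (2 ^ k)%:R.
  have e : dy k i.+1 = dy k i + T / (2 ^ k)%:R.
    by rewrite /dy -natr1 mulrDr mulr1 mulrDl.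
  have h : 0 <= T / (2 ^ k)%:R by rewrite divr_ge0// ltW.
  rewrite /clip e; set x := T / _ in h *.
  by case: (leP (dy k i) t) => ?; case: (leP (dy k i + x) t) => ?; lra.
move=> /le_lt_trans; apply; rewrite ltr_pdivrMr// mulrC -ltr_pdivrMr//.
have /truncn_itv/andP[_] : 0 <= T / d' by rewrite divr_ge0// ltW.
move=> /lt_le_trans; apply; rewrite ler_nat.
by rewrite (leq_trans _ (ltn_expl k (ltnSn 1)))// ltnS.
Qed.

Let S_refine k k' t eta : 0 <= t -> t <= T -> (k <= k')%N -> 0 <= eta ->
  (forall i, w (clip k i t) (clip k i.+1 t) `^ th <=
     eta * w (clip k i t) (clip k i.+1 t)) ->
  `|S k' t - S k t| <= sew_const th * K * (eta * w 0 t).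
Proof.
move=> t0 tT kk' e0 H; pose kap j := (j * 2 ^ (k' - k))%N.
have ck j : clip k' (kap j) t = clip k j t.
  rewrite /clip /kap /dy; congr (Num.min _ _).
  have -> : (2 ^ k' = 2 ^ k * 2 ^ (k' - k))%N by rewrite -expnD subnKC.
  rewrite !natrM invfM; set x := (2 ^ (k' - k))%:R; rewrite -!mulrA.
  congr (_ * (_ * _)); rewrite mulrCA mulfV ?mulr1//.
  by rewrite gt_eqF// /x ltr0n expn_gt0.
have kapk : kap (2 ^ k)%N = (2 ^ k')%N by rewrite /kap -expnD subnKC.
have := @refinement_sewing (clip k' ^~ t) kap (2 ^ k)%N eta (@clip_homo k' t).
rewrite clip0// kapk clipT// lexx => /(_ isT) /=.
have kaph : {homo kap : i j / (i <= j)%N >-> (i <= j)%N}.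
  by move=> i j ij; rewrite /kap leq_mul2r ij orbT.
move=> /(_ kaph tT (mul0n _)).
have -> : \sum_(0 <= j < 2 ^ k) Z (clip k' (kap j) t) (clip k' (kap j.+1) t)
  = S k t by apply: eq_bigr => i _; rewrite !ck.
have -> : \sum_(0 <= j < 2 ^ k) w (clip k' (kap j) t) (clip k' (kap j.+1) t)
  = \sum_(0 <= j < 2 ^ k) w (clip k j t) (clip k j.+1 t).
  by apply: eq_bigr => i _; rewrite !ck.
move=> h; apply: (le_trans (h _)) => [j jk|]; first by rewrite !ck.
apply: ler_wpM2l; first by rewrite mulr_ge0// ltW// sew_const_gt0.
rewrite ler_wpM2l//; have := @superadd_sum (clip k ^~ t) (2 ^ k)%N (@clip_homo k t).
by rewrite clip0// clipT// lexx => /(_ isT tT).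
Qed.

Let S_cvg t : 0 <= t -> t <= T -> cvg (S k t @[k --> \oo]).
Proof.
move=> t0 tT; apply/cauchy_cvgP/cauchy_exP => e e0.
set c := sew_const th * K * w 0 t.
have c0 : 0 <= c.
  by apply: mulr_ge0; [apply: mulr_ge0 => //; exact/ltW/sew_const_gt0|exact: w0].
have c1 : 0 < c + 1 by rewrite ltr_wpDl.
pose eta := e / (c + 1) / 2.
have eta0 : 0 < eta by rewrite !divr_gt0.
have [k0 k0P] := cells_small eta0.
exists (S k0 t); exists k0 => // k /= kk0.
rewrite -ball_normE /= distrC.
apply: (le_lt_trans (S_refine t0 tT kk0 (ltW eta0) _)) => [i|]; first exact: k0P.
have -> : sew_const th * K * (eta * w 0 t) = c * eta by rewrite /c; ring.
apply: (@le_lt_trans _ _ ((c + 1) * eta)); first by rewrite ler_wpM2r// ?(ltW eta0)// lerDl.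
rewrite /eta mulrA mulrCA mulfV ?gt_eqF// mulr1; lra.
Qed.

(** Splitting the partition of [0, t] at [s] only alters the cell containing [s],
    and the remaining sum over [s, t] is close to [Z s t]. *)
Let S_split k s t eta : 0 <= s -> s <= t -> t <= T -> 0 <= eta ->
  (forall i, w (clip k i t) (clip k i.+1 t) `^ th <=
     eta * w (clip k i t) (clip k i.+1 t)) ->
  `|S k t - S k s - Z s t| <=
    K * (eta * w 0 t) + sew_const th * K * w s t `^ th.
Proof.
move=> s0 st tT e0 H; have t0 := le_trans s0 st; have sT := le_trans st tT.
pose u i := Num.max s (clip k i t).
pose A := \sum_(0 <= i < 2 ^ k) Z (u i) (u i.+1).
have -> : S k t - S k s - Z s t = (S k t - S k s - A) + (A - Z s t) by zmod.
apply: (le_trans (ler_normD _ _)); apply: lerD.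
  have -> : S k t - S k s - A = \sum_(0 <= i < 2 ^ k) (Z (clip k i t) (clip k i.+1 t)
     - Z (clip k i s) (clip k i.+1 s) - Z (u i) (u i.+1)).
    by rewrite !sumrB.
  apply: (le_trans (ler_norm_sum _ _ _)).
  apply: (@le_trans _ _ (K * (eta * \sum_(0 <= i < 2 ^ k) w (clip k i t) (clip k i.+1 t)))).
    rewrite !mulr_sumr; apply: ler_sum => i _.
    have h1 : 0 <= clip k i t by rewrite -(@clip0 k t t0); exact: clip_homo.
    have h2 : clip k i.+1 t <= T by rewrite (le_trans _ tT)// /clip ge_min lexx orbT.
    have h3 : clip k i t <= clip k i.+1 t by exact: clip_homo.
    have d3 : dy k i <= dy k i.+1 by exact: dy_homo.
    apply: (@le_trans _ _ (K * w (clip k i t) (clip k i.+1 t) `^ th)); last first.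
      by rewrite ler_wpM2l.
    have r0 : 0 <= K * w (clip k i t) (clip k i.+1 t) `^ th.
      by rewrite mulr_ge0// powR_ge0.
    have [a|a] := leP (dy k i.+1) s.
      have b := le_trans d3 a.
      have e1 : clip k i t = clip k i s by rewrite /clip !min_l// (le_trans _ st).
      have e2 : clip k i.+1 t = clip k i.+1 s by rewrite /clip !min_l// (le_trans _ st).
      rewrite /u e1 e2 !max_l; try by rewrite /clip ge_min lexx orbT.
      by rewrite almost_additive_diag// subr0 subrr normr0 -e1 -e2.
    have [b|b] := leP s (dy k i).
      have c := le_trans b d3.
      have e1 : clip k i s = s by rewrite /clip min_r.
      have e2 : clip k i.+1 s = s by rewrite /clip min_r.
      rewrite /u e1 e2 !max_r; try by rewrite /clip le_min st ?b ?c.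
      by rewrite almost_additive_diag// subr0 subrr normr0.
    have e1 : clip k i s = clip k i t by rewrite /clip !min_l ?(ltW b)// (le_trans (ltW b)).
    have e2 : clip k i.+1 s = s by rewrite /clip min_r// ltW.
    have e3 : clip k i t <= s by rewrite /clip ge_min (ltW b).
    have e4 : s <= clip k i.+1 t by rewrite /clip le_min st (ltW a).
    rewrite /u e1 e2 (max_l e3) (max_r e4); exact: ZD.
  rewrite ler_wpM2l// ler_wpM2l//.
  have := @superadd_sum (clip k ^~ t) (2 ^ k)%N (@clip_homo k t).
  by rewrite clip0// clipT// lexx => /(_ isT tT).
have uh : {homo u : i j / (i <= j)%N >-> i <= j}.
  by move=> i j /(clip_homo k t) ij; rewrite /u ge_max !le_max lexx ij orbT.
have u0 : u 0%N = s by rewrite /u clip0// max_l.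
have uT : u (2 ^ k)%N = t by rewrite /u clipT// max_r.
by have := @partition_sewing u 0%N (2 ^ k)%N uh; rewrite u0 uT; apply.
Qed.

(** The sewing lemma: a map of intervals that is additive up to [w ^ th] with
    [th > 1] is that close to the increments of a path. *)
Theorem sewing : exists I : R -> E, I 0 = 0 /\
  forall s t, 0 <= s -> s <= t -> t <= T ->
    `|I t - I s - Z s t| <= sew_const th * K * w s t `^ th.
Proof.
exists (fun t => lim (S k t @[k --> \oo])); split.
  have -> : S^~ 0 = (fun=> 0).
    apply/funext => k; rewrite /S big1// => i _.
    have -> : clip k i 0 = 0 by rewrite /clip min_r// -(dy0 k); exact: dy_homo.
    have -> : clip k i.+1 0 = 0 by rewrite /clip min_r// -(dy0 k); exact: dy_homo.
    exact: almost_additive_diag.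
  exact: lim_cst.
move=> s t s0 st tT; have t0 := le_trans s0 st; have sT := le_trans st tT.
apply/ler_addgt0Pr => e e0.
have e3 : 0 < e / 3 by rewrite divr_gt0.
have wt0 : 0 <= K * w 0 t by rewrite mulr_ge0// w0.
pose eta := e / 3 / (K * w 0 t + 1).
have eta0 : 0 < eta by rewrite divr_gt0// ltr_wpDl.
have [k0 k0P] := cells_small eta0.
have ct := S_cvg t0 tT; have cs := S_cvg s0 sT.
near \oo => k.
have h1 : `|lim (S k t @[k --> \oo]) - S k t| < e / 3.
  by near: k; move/cvgrPdist_lt: ct; apply.
have h2 : `|lim (S k s @[k --> \oo]) - S k s| < e / 3.
  by near: k; move/cvgrPdist_lt: cs; apply.
have kk0 : (k0 <= k)%N by near: k; exact: nbhs_infty_ge.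
have h3 := S_split s0 st tT (ltW eta0) (fun i => k0P k kk0 t i t0 tT).
have h4 : K * (eta * w 0 t) <= e / 3.
  have -> : K * (eta * w 0 t) = e / 3 * ((K * w 0 t) / (K * w 0 t + 1)).
    by rewrite /eta; ring.
  by rewrite ler_piMr ?(ltW e3)// ler_pdivrMr ?mul1r ?lerDl// ltr_wpDl.
set a := lim _ in h1 *; set b := lim _ in h2 *.
have -> : a - b - Z s t = (a - S k t) - (b - S k s) + (S k t - S k s - Z s t) by zmod.
have := ler_normD ((a - S k t) - (b - S k s)) (S k t - S k s - Z s t).
have := ler_normB (a - S k t) (b - S k s); lra.
Unshelve. all: by end_near.
Qed.

End Sewing.

(** * The graded Banach algebra underlying a triple *)

Lemma normed_cvg_sum {R : realType} (E : normedModType R) (I : Type)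
    (F : set_system I) (FF : Filter F) (J : Type) (r : seq J)
    (f : J -> I -> E) (a : J -> E) : (forall j, f j @ F --> a j) ->
  (fun x => \sum_(j <- r) f j x) @ F --> \sum_(j <- r) a j.
Proof.
move=> fa; elim: r => [|j r IH].
  by under eq_fun do rewrite big_nil; rewrite big_nil; exact: cvg_cst.
by under eq_fun do rewrite big_cons; rewrite big_cons; exact: cvgD.
Qed.

Section BanachAlgebra.
Context {R : realType} (A : banach_algebra R).

Lemma banach_normM (x y : A) : `|x * y| <= `|x| * `|y|.
Proof. exact: (@ba_normM R A x y). Qed.

Lemma banach_cvgM (I : Type) (F : set_system I) (FF : Filter F) (f g : I -> A)
    (a b : A) : f @ F --> a -> g @ F --> b -> (fun x => f x * g x) @ F --> a * b.
Proof.
move=> fa gb; apply/cvgrPdist_lt => e e0.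
pose c := `|a| + `|b| + 1.
have c0 : 0 < c by rewrite ltr_wpDl// addr_ge0.
have d0 : 0 < Num.min 1 (e / (2 * c)) by rewrite lt_min ltr01 divr_gt0// mulr_gt0.
move/cvgrPdist_lt: fa => /(_ _ d0) fa; move/cvgrPdist_lt: gb => /(_ _ d0) gb.
near=> x.
have h1 : `|a - f x| < Num.min 1 (e / (2 * c)) by near: x.
have h2 : `|b - g x| < Num.min 1 (e / (2 * c)) by near: x.
have -> : a * b - f x * g x = (a - f x) * b + f x * (b - g x).
  by rewrite mulrBl mulrBr; zmod.
have h3 : `|f x| <= `|a| + 1.
  have -> : f x = a - (a - f x) by zmod.
  have := ler_normB a (a - f x); move: h1; rewrite lt_min => /andP[]; lra.
apply: (le_lt_trans (ler_normD _ _)).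
apply: (@le_lt_trans _ _ (`|a - f x| * `|b| + (`|a| + 1) * `|b - g x|)).
  apply: lerD; first exact: banach_normM.
  apply: (le_trans (banach_normM _ _)); exact: ler_wpM2r.
move: h1 h2; rewrite !lt_min => /andP[_ h1] /andP[_ h2].
have b0 : 0 <= `|b| by []. have a0 : 0 <= `|a| by [].
apply: (@le_lt_trans _ _ (e / (2 * c) * `|b| + (`|a| + 1) * `|b - g x|)).
  by rewrite lerD2r ler_wpM2r// ltW.
apply: (@lt_le_trans _ _ (e / (2 * c) * `|b| + (`|a| + 1) * (e / (2 * c)))).
  by rewrite ltrD2l ltr_pM2l// ltr_wpDl.
have -> : e / (2 * c) * `|b| + (`|a| + 1) * (e / (2 * c)) = e / 2.
  by rewrite /c; field; rewrite gt_eqF// ltr_wpDl// addr_ge0.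
lra.
Unshelve. all: by end_near.
Qed.

Lemma banach_cvgX (I : Type) (F : set_system I) (FF : Filter F) (f : I -> A)
    (a : A) k : f @ F --> a -> (fun x => f x ^+ k) @ F --> a ^+ k.
Proof.
move=> fa; elim: k => [|k IH].
  by under eq_fun do rewrite expr0; rewrite expr0; exact: cvg_cst.
by under eq_fun do rewrite exprS; rewrite exprS; exact: banach_cvgM.
Qed.

End BanachAlgebra.

Section Graded.
Context {R : realType} {V : completeNormedModType R} (W : tensor_powers V).
Context {S : eqType} (deg : S -> nat) (n : nat) (X : triple W deg n).

(** The homogeneous component of degree [k], as an element of the algebra. *)
Definition gpart k (a : X) : X := inj X k (proj X k a).

Lemma gpart_is_linear k : linear (gpart k).
Proof. by move=> c a b; rewrite /gpart !linearP. Qed.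

HB.instance Definition _ k :=
  GRing.isLinear.Build R X X _ (gpart k) (gpart_is_linear k).

Lemma gpart_sum (a : X) : a = \sum_(k < n.+1) gpart k a.
Proof. exact: talg_sum. Qed.

Lemma proj_gpart k (a : X) : (k <= n)%N -> proj X k (gpart k a) = proj X k a.
Proof. by move=> kn; rewrite /gpart /= injK. Qed.

Lemma gpart_inj j k (w : tpow W k) : (j <= n)%N -> (k <= n)%N ->
  gpart j (inj X k w) = if j == k then inj X k w else 0.
Proof.
move=> jn kn; rewrite /gpart /=; case: eqVneq => [->|jk]; first by rewrite injK.
by rewrite proj_inj// linear0.
Qed.

Lemma gpart_gpart j k (a : X) : (j <= n)%N -> (k <= n)%N ->
  gpart j (gpart k a) = if j == k then gpart k a else 0.
Proof. by move=> jn kn; exact: gpart_inj. Qed.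

Lemma norm_inj k (w : tpow W k) : (k <= n)%N -> `|inj X k w| = `|w|.
Proof.
move=> kn; rewrite (talg_norm (inj X k w)) (bigD1 (Ordinal (kn : (k < n.+1)%N)))//=.
rewrite injK// big1 ?addr0// => i ik; rewrite proj_inj ?normr0// -ltnS.
exact: ltn_ord.
Qed.

Lemma gpart_norm (a : X) : `|a| = \sum_(k < n.+1) `|gpart k a|.
Proof.
rewrite talg_norm; apply: eq_bigr => k _; rewrite /gpart /= norm_inj//.
by rewrite -ltnS ltn_ord.
Qed.

Lemma ler_gpart k (a : X) : (k <= n)%N -> `|gpart k a| <= `|a|.
Proof.
move=> kn; rewrite [leRHS]gpart_norm (bigD1 (Ordinal (kn : (k < n.+1)%N)))//=.
by rewrite lerDl sumr_ge0.
Qed.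

(** The map of a symbol only sees the component of its degree. *)
Lemma act_gpart s (a : X) : s \in symb X -> act X s a = act X s (gpart (deg s) a).
Proof.
move=> sX; have dn := symb_deg sX.
rewrite {1}(gpart_sum a) linear_sum (bigD1 (Ordinal (dn : (deg s < n.+1)%N)))//=.
rewrite big1 ?addr0// => i ik; rewrite /gpart /= act_graded//.
by rewrite -ltnS ltn_ord.
Qed.

Lemma gpart_act k (a : X) : (k <= n)%N ->
  gpart k a = \sum_(s <- symb X | deg s == k) inj X _ (act X s a).
Proof.
move=> kn; rewrite {1}(act_sum a) linear_sum big_mkcond [RHS]big_mkcond /=.
rewrite big_seq_cond [RHS]big_seq_cond; apply: eq_bigr => s; rewrite andbT => sX.
by rewrite gpart_inj ?(symb_deg sX)// eq_sym.
Qed.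

Lemma tmul0l i j (w : tpow W j) : tmul (0 : tpow W i) w = 0.
Proof.
have /= h := @tmul_linearl _ _ W i j w 1 0 0; move: h.
rewrite !scale1r addr0 => h.
by apply: (@addrI _ (tmul (0 : tpow W i) w)); rewrite addr0 -h.
Qed.

Lemma tmul0r i j (w : tpow W i) : tmul w (0 : tpow W j) = 0.
Proof.
have /= h := @tmul_linearr _ _ W i j w 1 0 0; move: h.
rewrite !scale1r addr0 => h.
by apply: (@addrI _ (tmul w (0 : tpow W j))); rewrite addr0 -h.
Qed.

Lemma gpart_ext (a b : X) : (forall k, (k <= n)%N -> gpart k a = gpart k b) -> a = b.
Proof.
move=> ab; rewrite (gpart_sum a) (gpart_sum b); apply: eq_bigr => k _.
by apply: ab; rewrite -ltnS ltn_ord.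
Qed.

(** Elements of degree [0] act as scalars. *)
Lemma inj0M (c : R) (b : X) : inj X 0 (c : R^o) * b = c *: b.
Proof.
have pc : proj X 0 (inj X 0 (c : R^o)) = (c : R^o) by rewrite injK.
apply: gpart_ext => -[|k] kn.
  by rewrite /gpart proj0M pc; congr (inj X 0 _); rewrite linearZ.
rewrite linearZ /= !gpart_act// scaler_sumr.
rewrite big_seq_cond [RHS]big_seq_cond; apply: eq_bigr => s /andP[sX /eqP sk].
have s1 : (1 <= deg s)%N by rewrite sk.
rewrite (Defs.actM sX s1) pc act_graded// ?sk// linear0 scaler0 add0r big_seq big1 ?addr0//.
move=> x xs; have [x1 x2 d1 d2 _] := redcopP sX s1 xs.
by rewrite (act_graded x1)// ?tmul0l ?linear0// neq_ltn d1.
Qed.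

Lemma inj0Mr (c : R) (b : X) : b * inj X 0 (c : R^o) = c *: b.
Proof.
have pc : proj X 0 (inj X 0 (c : R^o)) = (c : R^o) by rewrite injK.
apply: gpart_ext => -[|k] kn.
  rewrite /gpart proj0M pc; congr (inj X 0 _); rewrite linearZ.
  exact: mulrC.
rewrite linearZ /= !gpart_act// scaler_sumr.
rewrite big_seq_cond [RHS]big_seq_cond; apply: eq_bigr => s /andP[sX /eqP sk].
have s1 : (1 <= deg s)%N by rewrite sk.
rewrite (Defs.actM sX s1) pc act_graded// ?sk// linear0 scaler0 addr0 big_seq big1 ?addr0//.
move=> x xs; have [x1 x2 d1 d2 _] := redcopP sX s1 xs.
by rewrite (act_graded x2)// ?tmul0r ?linear0// neq_ltn d2.
Qed.

Lemma inj0_1 : inj X 0 (1 : R^o) = 1.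
Proof. by rewrite -[LHS]mulr1 inj0M scale1r. Qed.

Lemma injM_neq i j k (u : tpow W i) (v : tpow W j) :
  (i <= n)%N -> (j <= n)%N -> (k <= n)%N -> k != (i + j)%N ->
  gpart k (inj X i u * inj X j v) = 0.
Proof.
case: i u => [|i] u iN jn kn; first by rewrite add0n inj0M linearZ /= => kj;
  rewrite gpart_inj// (negbTE kj) scaler0.
case: j v jn => [|j] v jn; first by rewrite addn0 inj0Mr linearZ /= => kj;
  rewrite gpart_inj// (negbTE kj) scaler0.
move=> kij; case: k kn kij => [|k] kn kij.
  by rewrite /gpart /= proj0M proj_inj// mul0r linear0.
rewrite gpart_act// big_seq_cond big1// => s /andP[sX /eqP sk].
have s1 : (1 <= deg s)%N by rewrite sk.
rewrite (Defs.actM sX s1) !proj_inj// !scale0r !add0r big_seq big1//.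
move=> x xs; have [x1 x2 d1 d2 d12] := redcopP sX s1 xs.
have [e1|e1] := eqVneq (i.+1) (deg x.1); last first.
  by rewrite (act_graded x1)// ?tmul0l ?linear0.
have [e2|e2] := eqVneq (j.+1) (deg x.2); last first.
  by rewrite (act_graded x2)// ?tmul0r ?linear0.
by case/eqP: kij; rewrite -sk -d12 -e1 -e2.
Qed.

(** The product is graded. *)
Lemma gpartM k (a b : X) : (k <= n)%N ->
  gpart k (a * b) = \sum_(i < k.+1) gpart i a * gpart (k - i) b.
Proof.
move=> kn; rewrite {1}(gpart_sum a) {1}(gpart_sum b) big_distrlr /= linear_sum /=.
under eq_bigr do rewrite linear_sum.
have term (i j : nat) : (i <= n)%N -> (j <= n)%N ->
  gpart k (gpart i a * gpart j b) = if k == (i + j)%N then gpart i a * gpart j b else 0.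
  move=> iN jn; case: eqVneq => [e|ne]; last exact: injM_neq.
  rewrite [RHS]gpart_sum (bigD1 (Ordinal (kn : (k < n.+1)%N)))//= big1 ?addr0//.
  move=> l lk; apply: injM_neq => //; first by rewrite -ltnS ltn_ord.
  by rewrite -e; exact: lk.
have kn' : (k.+1 <= n.+1)%N by [].
rewrite (big_ord_widen _ (fun i => gpart i a * gpart (k - i) b) kn') big_mkcond /=.
rewrite [RHS]big_mkcond; apply: eq_bigr => i _ /=.
have iN : (i <= n)%N by rewrite -ltnS ltn_ord.
case: ltnP => ik.
  have kiN : (k - i < n.+1)%N by rewrite ltnS (leq_trans (leq_subr _ _)).
  rewrite (bigD1 (Ordinal kiN))//= term// subnKC// eqxx big1 ?addr0// => j jk.
  rewrite term ?leq_ord//; case: eqVneq => // e.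
  by case/eqP: jk; apply/val_inj; rewrite /= e addKn.
rewrite big1// => j _; rewrite term ?leq_ord//.
by case: eqVneq => // e; move: ik; rewrite e ltnNge leq_addr.
Qed.

Lemma ugrpP (a : X) : ugrp X a <-> gpart 0 a = 1.
Proof.
rewrite /ugrp /gpart /=; split=> [->|h]; first exact: inj0_1.
by rewrite -[proj X 0 a](@injK _ _ _ _ _ _ X 0)// h -inj0_1 injK.
Qed.

Lemma gpart0M (a b : X) : gpart 0 (a * b) = gpart 0 a * gpart 0 b.
Proof. by rewrite gpartM// big_ord1. Qed.

Lemma ugrp1 : ugrp X 1.
Proof. by apply/ugrpP; rewrite -inj0_1 gpart_inj. Qed.

Lemma gpart1 k : (0 < k <= n)%N -> gpart k 1 = 0 :> X.
Proof. by case/andP => k0 kn; rewrite -inj0_1 gpart_inj// gt_eqF. Qed.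

Lemma norm_one : `|1 : X| = 1.
Proof. by rewrite -inj0_1 norm_inj// normr1. Qed.

Lemma ugrpM (a b : X) : ugrp X a -> ugrp X b -> ugrp X (a * b).
Proof. by move=> /ugrpP a1 /ugrpP b1; apply/ugrpP; rewrite gpart0M a1 b1 mulr1. Qed.

(** The inverse in [ugrp X], as a polynomial: [1 - a] is nilpotent. *)
Definition tinv (a : X) : X := \sum_(k < n.+1) (1 - a) ^+ k.

Lemma gpart_nilp (a : X) j k : gpart 0 a = 0 -> (k < j)%N -> (k <= n)%N ->
  gpart k (a ^+ j) = 0.
Proof.
move=> a0; elim: j k => // j IH k kj kn; rewrite exprS gpartM// big1// => -[[|i] /= ik] _.
  by rewrite a0 mul0r.
by rewrite IH ?mulr0//; move: kj ik kn; rewrite ?ltnS; lia.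
Qed.

Lemma ugrp_nilp (a : X) : ugrp X a -> (1 - a) ^+ n.+1 = 0.
Proof.
move=> /ugrpP a1; apply: gpart_ext => k kn; rewrite linear0 gpart_nilp//.
by rewrite linearB /= a1 (ugrpP _).1 ?subrr//; exact: ugrp1.
Qed.

Lemma mul_tinv (a : X) : ugrp X a -> a * tinv a = 1.
Proof.
move=> aG; have := subrX1 (1 - a) n.+1; rewrite ugrp_nilp// sub0r => h.
apply: oppr_inj; rewrite h -/(tinv a) (_ : 1 - a - 1 = - a) ?mulNr//.
by rewrite addrAC subrr add0r.
Qed.

Lemma tinv_mul (a : X) : ugrp X a -> tinv a * a = 1.
Proof.
move=> aG; rewrite -[RHS](mul_tinv aG) /tinv mulr_suml mulr_sumr.
apply: eq_bigr => k _; apply/esym/commrX; rewrite /GRing.comm mulrBl mulrBr.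
by rewrite mulr1 mul1r.
Qed.

Lemma ugrp_unit (a : X) : ugrp X a -> a \is a GRing.unit.
Proof. by move=> aG; apply/unitrP; exists (tinv a); rewrite mul_tinv// tinv_mul. Qed.

Lemma ugrp_invE (a : X) : ugrp X a -> a^-1 = tinv a.
Proof.
move=> aG; rewrite -[LHS]mulr1 -(mul_tinv aG) mulrA mulVr ?mul1r//.
exact: ugrp_unit.
Qed.

Lemma ugrp_tinv (a : X) : ugrp X a -> ugrp X (tinv a).
Proof.
move=> aG; apply/ugrpP; have := mul_tinv aG => /(congr1 (gpart 0)).
by rewrite gpart0M ((ugrpP _).1 aG) mul1r ((ugrpP _).1 ugrp1).
Qed.

Lemma ugrpV (a : X) : ugrp X a -> ugrp X a^-1.
Proof. by move=> aG; rewrite ugrp_invE//; exact: ugrp_tinv. Qed.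

Lemma tinv_cvg (I : Type) (F : set_system I) (FF : Filter F) (f : I -> X) (a : X) :
  f @ F --> a -> (fun x => tinv (f x)) @ F --> tinv a.
Proof.
move=> fa; rewrite /tinv; apply: normed_cvg_sum => k.
apply: banach_cvgX; apply: cvgB => //; exact: cvg_cst.
Qed.

Lemma norm_tinv (a : X) (B : R) : `|a| <= B -> `|tinv a| <= \sum_(k < n.+1) (1 + B) ^+ k.
Proof.
move=> aB; rewrite /tinv; apply: (le_trans (ler_norm_sum _ _ _)).
apply: ler_sum => k _.
have h : `|1 - a| <= 1 + B.
  by apply: (le_trans (ler_normB _ _)); rewrite norm_one lerD2l.
elim: (k : nat) => [|j IH]; first by rewrite !expr0 norm_one.
rewrite !exprS; apply: (le_trans (banach_normM _ _)); exact: ler_pM.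
Qed.

(** Multiplication by an element of [ugrp X] does not change the first possibly
    nonzero component. *)
Lemma gpartM_low k (a b : X) m : (k <= m.+1)%N -> (k <= n)%N ->
  (forall i, (i <= m)%N -> (i <= n)%N -> gpart i b = 0) -> ugrp X a ->
  gpart k (a * b) = gpart k b.
Proof.
move=> km kn b0 /ugrpP a1; rewrite gpartM// big_ord_recl a1 mul1r subn0.
rewrite big1 ?addr0// => i _; rewrite b0 ?mulr0//= /bump /=; have := ltn_ord i; lia.
Qed.

Lemma gpartM_lowr k (a b : X) m : (k <= m.+1)%N -> (k <= n)%N ->
  (forall i, (i <= m)%N -> (i <= n)%N -> gpart i b = 0) -> ugrp X a ->
  gpart k (b * a) = gpart k b.
Proof.
move=> km kn b0 /ugrpP a1; rewrite gpartM// big_ord_recr /= subnn a1 mulr1.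
rewrite big1 ?add0r// => i _; rewrite b0 ?mul0r//=; have := ltn_ord i; lia.
Qed.

(** The products of components of positive degree in degree [k] of [a * b]. *)
Lemma gpartM_cross k (a b : X) : (0 < k <= n)%N -> ugrp X a -> ugrp X b ->
  gpart k (a * b) = gpart k a + gpart k b +
    \sum_(1 <= i < k) gpart i a * gpart (k - i) b.
Proof.
case: k => // k /= kn /ugrpP a1 /ugrpP b1; rewrite gpartM//.
rewrite -(big_mkord xpredT (fun i => gpart i a * gpart (k.+1 - i) b)).
by rewrite big_ltn// a1 mul1r subn0 big_nat_recr//= subnn b1 mulr1; zmod.
Qed.

(** If the components of degree [i] are of size [x^i] and [y^i], the cross terms
    in degree [k] are of size [max(x, y)^k]. *)
Lemma norm_cross k (a b : X) (C x y r : R) : (k <= n)%N ->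
  0 <= C -> 0 <= x -> 0 <= y -> x <= r -> y <= r ->
  (forall i, (0 < i < k)%N -> `|gpart i a| <= C * x ^+ i) ->
  (forall i, (0 < i < k)%N -> `|gpart i b| <= C * y ^+ i) ->
  `|\sum_(1 <= i < k) gpart i a * gpart (k - i) b| <= k%:R * C ^+ 2 * r ^+ k.
Proof.
move=> kn C0 x0 y0 xr yr Ha Hb; have r0 := le_trans x0 xr.
apply: (le_trans (ler_norm_sum _ _ _)).
apply: (@le_trans _ _ (\sum_(1 <= i < k) C ^+ 2 * r ^+ k)).
  rewrite big_nat_cond [leRHS]big_nat_cond; apply: ler_sum => i.
  rewrite andbT => /andP[i1 ik]; apply: (le_trans (banach_normM _ _)).
  have -> : C ^+ 2 * r ^+ k = (C * r ^+ i) * (C * r ^+ (k - i)).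
    by rewrite -{1}(subnKC (ltnW ik)) exprD; ring.
  apply: ler_pM => //.
    by rewrite (le_trans (Ha _ _)) ?i1// ler_wpM2l// lerXn2r// ?nnegrE.
  rewrite (le_trans (Hb _ _))//; first lia.
  by rewrite ler_wpM2l// lerXn2r// ?nnegrE.
rewrite sumr_const_nat -mulrA -[leLHS]mulr_natl ler_wpM2r//.
  by rewrite mulr_ge0// exprn_ge0.
by rewrite ler_nat leq_subr.
Qed.

End Graded.

(** * Raising the level of a multiplicative path *)

(** A superadditive function of intervals that is uniformly small on short
    intervals. *)
Record fine_control (R : realType) (T : R) (w : R -> R -> R) : Prop := {
  fine_control_ge0 : forall s t, 0 <= s -> s <= t -> t <= T -> 0 <= w s t;
  fine_controlD : forall s u t, 0 <= s -> s <= u -> u <= t -> t <= T ->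
    w s u + w u t <= w s t;
  fine_control_small : forall e, 0 < e -> exists2 d, 0 < d &
    forall s t, 0 <= s -> s <= t -> t <= T -> t - s < d -> w s t < e
}.

Section Level.
Context {R : realType} {V : completeNormedModType R} (W : tensor_powers V).
Context {S : eqType} (deg : S -> nat) (n : nat) (X : triple W deg n).
Context (p : R) (p1 : 1 <= p).

Let p0 : 0 < p := lt_le_trans ltr01 p1.

Lemma incr_ugrp (x : R -> X) s t : ugrp X (x s) -> ugrp X (x t) -> ugrp X (incr x s t).
Proof. by move=> xs xt; apply: ugrpM => //; exact: ugrpV. Qed.

Lemma incrM (x : R -> X) s u t : ugrp X (x u) -> incr x s t = incr x s u * incr x u t.
Proof. by move=> /ugrp_unit xu; rewrite /incr mulrA mulrK. Qed.

(** Perturbing [a] and [b] above degree [m] changes [a^-1 * b] additively in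
    degree [m + 1]. *)
Lemma gpart_perturb m (a b u v : X) :
  ugrp X a -> ugrp X b -> 
  (forall k, (k <= m)%N -> (k <= n)%N -> gpart k u = 0) ->
  (forall k, (k <= m)%N -> (k <= n)%N -> gpart k v = 0) ->
  forall k, (k <= m.+1)%N -> (k <= n)%N ->
    gpart k ((a + u)^-1 * (b + v)) = gpart k (a^-1 * b) + gpart k v - gpart k u.
Proof.
move=> aG bG u0 v0 k km kn.
have aG' : ugrp X (a + u).
  by apply/ugrpP; rewrite linearD /= u0// addr0; exact/ugrpP.
have cG : ugrp X (a^-1 * b) by apply: ugrpM => //; exact: ugrpV.
have -> : (a + u)^-1 * (b + v) =
    a^-1 * b + (a + u)^-1 * (v - u * (a^-1 * b)).
  apply: (mulrI (ugrp_unit aG')); rewrite [RHS]mulrDr !mulVKr ?ugrp_unit//.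
  rewrite mulrDl mulVKr ?ugrp_unit//; zmod.
have uc i : (i <= m.+1)%N -> (i <= n)%N -> gpart i (u * (a^-1 * b)) = gpart i u.
  by move=> im iN; apply: (gpartM_lowr im iN).
have low i : (i <= m)%N -> (i <= n)%N -> gpart i (v - u * (a^-1 * b)) = 0.
  by move=> im iN; rewrite linearB /= v0// uc ?u0 ?subrr//; exact: leqW.
rewrite linearD /= (gpartM_low km kn low (ugrpV aG')) linearB /= uc//.
by rewrite addrA.
Qed.

(** [x] is a path of [ugrp X] issued from [1] whose increments over [s, t] have
    components of degree [k <= m] of size [w s t ^ (k / p)]. *)
Record level_bound (T : R) (w : R -> R -> R) (m : nat) (C : R) (x : R -> X) : Prop := {
  level_ugrp : forall t, 0 <= t -> t <= T -> ugrp X (x t);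
  level_start : x 0 = 1;
  level_le : forall s t k, 0 <= s -> s <= t -> t <= T -> (0 < k <= m)%N ->
    `|gpart k (incr x s t)| <= C * (w s t `^ p^-1) ^+ k
}.

(** From degree [m] to degree [m + 1]: sew the components of degree [m + 1] of the
    increments and subtract the result from the path. The new constant does not
    depend on the path. *)
Lemma level_step m C : (m < n)%N -> p < m.+1%:R -> 0 <= C ->
  exists2 C', C <= C' & forall T w x, 0 <= T -> fine_control T w ->
    level_bound T w m C x ->
    exists2 x', level_bound T w m.+1 C' x' &
      forall t k, 0 <= t -> t <= T -> (k <= m)%N -> gpart k (x' t) = gpart k (x t).
Proof.
move=> mn pm C0; pose th := m.+1%:R / p; pose K := m.+1%:R * C ^+ 2.
have th1 : 1 < th by rewrite /th ltr_pdivlMr// mul1r.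
have K0 : 0 <= K by rewrite mulr_ge0// exprn_ge0.
exists (C + sew_const th * K).
  by rewrite lerDl mulr_ge0// ltW// sew_const_gt0.
move=> T w x T0 [w0 wD wS] [xG x0 xC].
pose Z s t : X := gpart m.+1 (incr x s t).
have ZD s u t : 0 <= s -> s <= u -> u <= t -> t <= T ->
    `|Z s t - Z s u - Z u t| <= K * w s t `^ th.
  move=> s0 su ut tT.
  have u0 := le_trans s0 su; have uT := le_trans ut tT.
  have t0 := le_trans u0 ut; have sT := le_trans su uT.
  have Gs := xG s s0 sT; have Gu := xG u u0 uT; have Gt := xG t t0 tT.
  rewrite /Z (@incrM x s u t)// gpartM_cross//; try exact: incr_ugrp.
  set c := \sum_(_ <= _ < _) _.
  rewrite (_ : _ - _ - _ = c); last by zmod.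
  have wsu0 := w0 s u s0 su uT; have wut0 := w0 u t u0 ut tT.
  have wst := wD s u t s0 su ut tT.
  rewrite /th -expr_powR; last lra.
  apply: (@norm_cross _ _ _ _ _ _ X m.+1 _ _ C (w s u `^ p^-1) (w u t `^ p^-1)) => //.
  - exact: powR_ge0.
  - exact: powR_ge0.
  - by apply: powR_mono; rewrite ?invr_ge0 ?(ltW p0)//; lra.
  - by apply: powR_mono; rewrite ?invr_ge0 ?(ltW p0)//; lra.
  - by move=> i; apply: xC.
  - by move=> i; apply: xC.
have [I [I0 IP]] := sewing th1 K0 T0 w0 wD wS ZD.
pose J t : X := - gpart m.+1 (I t).
have JJ k t : (k <= n)%N -> gpart k (J t) = if k == m.+1 then J t else 0.
  by move=> kn; rewrite /J linearN /= gpart_gpart//; case: eqP => // _; rewrite oppr0.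
have J0 k t : (k <= m)%N -> (k <= n)%N -> gpart k (J t) = 0.
  by move=> km kn; rewrite JJ// ltn_eqF.
exists (fun t => x t + J t); last first.
  move=> t k t0 tT km; rewrite linearD /= J0 ?addr0//.
  exact: (leq_trans km (ltnW mn)).
split.
- by move=> t t0 tT; apply/ugrpP; rewrite linearD /= J0// addr0; exact/ugrpP/xG.
- by rewrite /J I0 linear0 oppr0 addr0.
move=> s t k s0 st tT /andP[k0 km].
have t0 := le_trans s0 st; have sT := le_trans st tT.
have kn : (k <= n)%N by exact: leq_trans km mn.
have Gs := xG s s0 sT; have Gt := xG t t0 tT.
have wst := w0 s t s0 st tT.
rewrite /incr (@gpart_perturb m)// => [|i|i]; try exact: J0.
have rk : 0 <= (w s t `^ p^-1) ^+ k by rewrite exprn_ge0// powR_ge0.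
move: km; rewrite leq_eqVlt => /orP[/eqP ek|km]; last first.
  rewrite !J0// addr0 subr0; apply: (le_trans (xC _ _ _ s0 st tT _)); first by rewrite k0.
  by rewrite ler_wpM2r// lerDl mulr_ge0// ltW// sew_const_gt0.
rewrite ek in kn rk *; rewrite !JJ// eqxx mulrDl.
rewrite (_ : _ + _ - _ = - gpart m.+1 (I t - I s - Z s t)); last first.
  by rewrite !linearB /= /Z gpart_gpart// eqxx /J /incr; zmod.
rewrite normrN; apply: (le_trans (ler_gpart _ _)) => //.
apply: (le_trans (IP s t s0 st tT)).
rewrite expr_powR// -/th lerDr mulr_ge0// powR_ge0//.
Qed.

Lemma level_extend N m C : (N <= m <= n)%N -> p < N.+1%:R -> 0 <= C ->
  exists2 C', C <= C' & forall T w x, 0 <= T -> fine_control T w ->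
    level_bound T w N C x ->
    exists2 x', level_bound T w m C' x' &
      forall t k, 0 <= t -> t <= T -> (k <= N)%N -> gpart k (x' t) = gpart k (x t).
Proof.
move=> + pN C0; elim: m => [|m IH] /andP[Nm mn].
  by exists C => // T w x T0 wf xb; exists x => //; move: Nm; rewrite leqn0 => /eqP <-.
move: Nm; rewrite leq_eqVlt => /orP[/eqP <-|Nm].
  by exists C => // T w x T0 wf xb; exists x.
have [|C1 CC1 H1] := IH; first by rewrite -ltnS Nm ltnW.
have pm : p < m.+1%:R by rewrite (lt_le_trans pN)// ler_nat.
have [C2 CC2 H2] := level_step mn pm (le_trans C0 CC1).
exists C2; first exact: le_trans CC2.
move=> T w x T0 wf xb; have [y yb yx] := H1 T w x T0 wf xb.
have [z zb zy] := H2 T w y T0 wf yb; exists z => // t k t0 tT kN.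
by rewrite zy// ?yx// (leq_trans kN).
Qed.

End Level.

(** * Ordered products of local approximations *)

Section Products.
Context {R : realType} {V : completeNormedModType R} (W : tensor_powers V).
Context {S : eqType} (deg : S -> nat) (n : nat) (X : triple W deg n).

(** An ordered product whose factors are close to the increments of a bounded
    path stays close to that path. *)
Lemma product_stability (h a : nat -> X) (B B' : R) (l : nat) :
  (forall i, (i <= l)%N -> ugrp X (h i)) -> h 0%N = 1 ->
  (forall i, (i <= l)%N -> `|h i| <= B) ->
  (forall i, (i <= l)%N -> `|(h i)^-1| <= B') ->
  let eps i := B * B' * `|a i - (h i)^-1 * h i.+1| in
  \sum_(0 <= i < l) eps i <= 1 / 2 ->
  `|\prod_(0 <= i < l) a i - h l| <= 2 * B * \sum_(0 <= i < l) eps i.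
Proof.
move=> hG h0 hB hB' eps eps2.
have B0 : 0 <= B by exact: le_trans (normr_ge0 _) (hB 0%N (leq0n _)).
have B'0 : 0 <= B' by exact: le_trans (normr_ge0 _) (hB' 0%N (leq0n _)).
have e0 i : 0 <= eps i by rewrite /eps !mulr_ge0.
(* the ratio of the partial product to the path moves by at most [2 * eps] per step *)
pose Q j := \prod_(0 <= i < j) a i * (h j)^-1.
have epsj j : (j <= l)%N -> \sum_(0 <= i < j) eps i <= 1 / 2.
  move=> jl; apply: le_trans eps2; rewrite [leRHS](big_cat_nat _ (n := j))//=.
  by rewrite lerDl sumr_ge0.
have QP j : (j <= l)%N -> `|Q j - 1| <= 2 * \sum_(0 <= i < j) eps i.
  elim: j => [|j IH] jl.
    by rewrite /Q !big_geq// h0 invr1 mulr1 subrr normr0 mulr0.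
  have {}IH := IH (ltnW jl).
  have Qj : `|Q j| <= 2.
    have -> : Q j = (Q j - 1) + 1 by zmod.
    apply: (le_trans (ler_normD _ _)); rewrite norm_one.
    have := epsj j (ltnW jl); lra.
  have QS : Q j.+1 - Q j = Q j * h j * (a j - (h j)^-1 * h j.+1) * (h j.+1)^-1.
    rewrite /Q big_nat_recr//= mulrVK ?(ugrp_unit (hG j (ltnW jl)))//.
    by rewrite mulrBr mulrBl !mulrA mulrK// (ugrp_unit (hG _ jl)).
  have -> : Q j.+1 - 1 = (Q j - 1) + (Q j.+1 - Q j) by zmod.
  rewrite big_nat_recr//= mulrDr; apply: (le_trans (ler_normD _ _)).
  apply: lerD => //; rewrite QS.
  apply: (le_trans (banach_normM _ _)).
  apply: (@le_trans _ _ (2 * B * `|a j - (h j)^-1 * h j.+1| * B')).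
    apply: ler_pM => //; last exact: hB'.
    apply: (le_trans (banach_normM _ _)); apply: ler_pM => //.
    apply: (le_trans (banach_normM _ _)); apply: ler_pM => //.
    exact/hB/ltnW.
  by rewrite /eps le_eqVlt; apply/orP; left; apply/eqP; ring.
have -> : \prod_(0 <= i < l) a i - h l = (Q l - 1) * h l.
  by rewrite mulrBl mul1r /Q mulrVK// (ugrp_unit (hG l (leqnn l))).
apply: (le_trans (banach_normM _ _)).
have -> : 2 * B * \sum_(0 <= i < l) eps i = (2 * \sum_(0 <= i < l) eps i) * B by ring.
by apply: ler_pM => //; [exact: QP|exact: hB].
Qed.

Context (p : R) (p1 : 1 <= p).
Let p0 : 0 < p := lt_le_trans ltr01 p1.

Context (T : R) (v : R -> R) (C : R) (h : R -> X).
Hypothesis T0 : 0 <= T.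
Hypothesis C0 : 0 <= C.
Hypothesis v_homo : forall s t, 0 <= s -> s <= t -> t <= T -> v s <= v t.
Hypothesis hb : level_bound p T (fun s t => v t - v s) n C h.

(** A bound for [h] on [0, T]. *)
Definition level_norm : R :=
  1 + \sum_(1 <= k < n.+1) C * ((v T - v 0) `^ p^-1) ^+ k.

Definition level_inv_norm : R := \sum_(k < n.+1) (1 + level_norm) ^+ k.

Lemma norm_incr_le s t : 0 <= s -> s <= t -> t <= T ->
  `|incr h s t| <= level_norm.
Proof.
move=> s0 st tT; have t0 := le_trans s0 st; have sT := le_trans st tT.
have G : ugrp X (incr h s t) by apply: incr_ugrp; exact: (level_ugrp hb).
rewrite gpart_norm -(big_mkord xpredT (fun k => `|gpart k (incr h s t)|)).
rewrite big_ltn// ((ugrpP _).1 G) norm_one lerD2l.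
rewrite big_nat_cond [leRHS]big_nat_cond; apply: ler_sum => k /andP[kn _].
apply: (le_trans (level_le hb s0 st tT kn)); rewrite ler_wpM2l//.
rewrite lerXn2r ?nnegrE ?powR_ge0//; apply: powR_mono.
- by rewrite invr_ge0 ltW.
- by rewrite subr_ge0 v_homo.
- have := v_homo (lexx 0) s0 sT; have := v_homo t0 tT (lexx T); lra.
Qed.

Lemma norm_level_le t : 0 <= t -> t <= T -> `|h t| <= level_norm.
Proof.
move=> t0 tT; have := norm_incr_le (lexx 0) t0 tT.
by rewrite /incr (level_start hb) invr1 mul1r.
Qed.

Lemma norm_level_inv_le t : 0 <= t -> t <= T -> `|(h t)^-1| <= level_inv_norm.
Proof.
move=> t0 tT; rewrite ugrp_invE; last exact: (level_ugrp hb).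
exact/norm_tinv/norm_level_le.
Qed.

Lemma level_norm_ge0 : 0 <= level_norm.
Proof. by rewrite (le_trans _ (norm_level_le (lexx 0) T0)). Qed.

Lemma level_inv_norm_ge0 : 0 <= level_inv_norm.
Proof. by rewrite (le_trans _ (norm_level_inv_le (lexx 0) T0)). Qed.

Hypothesis v_small : forall e, 0 < e -> exists2 d, 0 < d &
  forall s t, 0 <= s -> s <= t -> t <= T -> t - s < d -> v t - v s < e.

(** Elements agreeing with the increments of [h] up to a degree [N] with
    [N + 1 > p] multiply up to [h] as the mesh tends to [0]. *)
Lemma product_approx N : p < N.+1%:R -> forall e, 0 < e -> exists2 d, 0 < d &
  forall (tau : nat -> R) (l : nat) (a : nat -> X),
    {homo tau : i j / (i <= j)%N >-> i <= j} -> tau 0%N = 0 -> tau l <= T ->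
    (forall i, (i < l)%N -> tau i.+1 - tau i < d) ->
    (forall i k, (i < l)%N -> (k <= N)%N -> (k <= n)%N ->
       gpart k (a i) = gpart k (incr h (tau i) (tau i.+1))) ->
    (forall i k, (i < l)%N -> (N < k <= n)%N ->
       `|gpart k (a i)| <= C * ((v (tau i.+1) - v (tau i)) `^ p^-1) ^+ k) ->
    `|\prod_(0 <= i < l) a i - h (tau l)| < e.
Proof.
move=> pN e e0; have B0 := level_norm_ge0; have B'0 := level_inv_norm_ge0.
set B := level_norm in B0; set B' := level_inv_norm in B'0.
have th1 : 1 < N.+1%:R / p by rewrite ltr_pdivlMr// mul1r.
pose K := n.+1%:R * (2 * C); have K0 : 0 <= K by rewrite !mulr_ge0.
pose c := B * B' * K * (v T - v 0).
have vT0 : 0 <= v T - v 0 by rewrite subr_ge0 v_homo.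
have c0 : 0 <= c by rewrite !mulr_ge0.
pose m := Num.min (1 / 2) (e / (4 * (B + 1))).
have m0 : 0 < m by rewrite lt_min !divr_gt0// mulr_gt0// ltr_wpDl.
pose eta := m / (c + 1).
have eta0 : 0 < eta by rewrite divr_gt0// ltr_wpDl.
have etac : eta * c <= m.
  rewrite /eta -mulrA ler_piMr ?(ltW m0)// mulrC ler_pdivrMr ?mul1r ?lerDl//.
  by rewrite ltr_wpDl.
have [d1 d10 d1P] := powR_small th1 eta0.
have d1'0 : 0 < Num.min d1 1 by rewrite lt_min d10 ltr01.
have [d d0 dP] := v_small d1'0.
exists d => // tau l a tm t00 tl mesh alow ahigh.
have tge i : 0 <= tau i by rewrite -t00 tm.
have tle i : (i <= l)%N -> tau i <= T by move=> il; rewrite (le_trans _ tl)// tm.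
pose rho i := (v (tau i.+1) - v (tau i)) `^ p^-1.
have loc i : (i < l)%N ->
    `|a i - incr h (tau i) (tau i.+1)| <= K * (eta * (v (tau i.+1) - v (tau i))).
  move=> il; have ti := tge i; have tii := tm _ _ (leqnSn i); have tiT := tle _ il.
  have om0 : 0 <= v (tau i.+1) - v (tau i) by rewrite subr_ge0 v_homo.
  have := dP _ _ ti tii tiT (mesh _ il); rewrite lt_min => /andP[om1 om2].
  have r0 : 0 <= rho i by exact: powR_ge0.
  have r1 : rho i <= 1.
    have := @powR_mono R (v (tau i.+1) - v (tau i)) 1 p^-1; rewrite powR1.
    by apply => //; rewrite ?invr_ge0 ltW.
  apply: (@le_trans _ _ (K * rho i ^+ N.+1)); last first.
    by rewrite ler_wpM2l// expr_powR//; exact: d1P.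
  rewrite gpart_norm; apply: (@le_trans _ _ (\sum_(k < n.+1) (2 * C) * rho i ^+ N.+1)).
    apply: ler_sum => k _; have kn : (k <= n)%N by exact: leq_ord.
    rewrite linearB /=; have [kN|kN] := leqP k N.
      by rewrite alow// subrr normr0 !mulr_ge0// exprn_ge0.
    apply: (le_trans (ler_normB _ _)).
    apply: (@le_trans _ _ (C * rho i ^+ k + C * rho i ^+ k)).
      apply: lerD; first by apply: ahigh; rewrite // kN.
      by apply: (level_le hb) => //; rewrite kn (leq_ltn_trans _ kN).
    rewrite -mulrDl -mulr2n -(mulr_natl C) ler_wpM2l ?mulr_ge0//.
    by rewrite ler_wiXn2l.
  by rewrite sumr_const card_ord -[leLHS]mulr_natl /K mulrA.
have h00 : h (tau 0%N) = 1 by rewrite t00 (level_start hb).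
have hG i : (i <= l)%N -> ugrp X (h (tau i)).
  by move=> il; apply: (level_ugrp hb) => //; exact: tle.
have nB i : (i <= l)%N -> `|h (tau i)| <= B.
  by move=> il; apply: norm_level_le => //; exact: tle.
have nB' i : (i <= l)%N -> `|(h (tau i))^-1| <= B'.
  by move=> il; apply: norm_level_inv_le => //; exact: tle.
have := @product_stability (fun i => h (tau i)) a B B' l hG h00 nB nB' => /=.
set s := \sum_(0 <= i < l) _.
have sm : s <= m.
  apply: le_trans etac; apply: (@le_trans _ _ (\sum_(0 <= i < l)
      B * B' * (K * (eta * (v (tau i.+1) - v (tau i)))))).
    rewrite /s big_nat_cond [leRHS]big_nat_cond; apply: ler_sum => i.
    rewrite andbT => /= il; rewrite ler_wpM2l ?mulr_ge0//; exact: loc.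
  rewrite -!mulr_sumr telescope_sumr// t00 /c.
  have -> : eta * (B * B' * K * (v T - v 0)) = B * B' * (K * (eta * (v T - v 0))).
    by ring.
  apply: ler_wpM2l; first by rewrite mulr_ge0.
  apply: ler_wpM2l => //; apply: ler_wpM2l; first exact: ltW.
  by rewrite lerD2r v_homo.
have := sm; rewrite le_min => /andP[s1 s2] /(_ s1) /le_lt_trans; apply.
apply: (@le_lt_trans _ _ (2 * B * (e / (4 * (B + 1))))).
  by rewrite ler_wpM2l// mulr_ge0.
have b1 : 0 < B + 1 by rewrite ltr_wpDl.
have -> : 2 * B * (e / (4 * (B + 1))) = e * (B / (2 * (B + 1))).
  by field; rewrite gt_eqF.
rewrite -[ltRHS]mulr1 ltr_pM2l// ltr_pdivrMr ?mulr_gt0// mul1r; lra.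
Qed.

End Products.

(** * Superadditive variation of a continuous function of intervals *)

Section PowRContinuity.
Context {R : realType}.

Lemma powRK (x r : R) : r != 0 -> 0 <= x -> (x `^ r^-1) `^ r = x.
Proof. by move=> r0 x0; rewrite -powRrM mulVf// powRr1. Qed.

Lemma powR_near (r c e : R) : 0 < r -> 0 <= c -> 0 < e ->
  exists2 d, 0 < d & forall x, 0 <= x -> `|c - x| < d -> `|c `^ r - x `^ r| < e.
Proof.
move=> r0 c0 e0; have rn0 : r != 0 by rewrite gt_eqF.
set y := c `^ r; have y0 : 0 <= y by exact: powR_ge0.
have mono u v : 0 <= u -> u < v -> u `^ r < v `^ r.
  by move=> u0 uv; apply: gt0_ltr_powR; rewrite // nnegrE ?(le_trans u0 (ltW uv)).
have lt_of u v : 0 <= u -> 0 <= v -> u `^ r < v `^ r -> u < v.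
  move=> u0 v0; apply: contraTT; rewrite -!leNgt => vu.
  by apply: powR_mono => //; exact: ltW.
have ub : c < (y + e) `^ r^-1.
  apply: lt_of; rewrite ?powR_ge0// powRK ?addr_ge0 ?(ltW e0)// -/y; lra.
have [ye|ye] := ltP y e.
  exists ((y + e) `^ r^-1 - c); first by rewrite subr_gt0.
  move=> x x0 xc; have x1 : x < (y + e) `^ r^-1 by move: xc; rewrite ltr_norml; lra.
  have := mono _ _ x0 x1; rewrite powRK ?addr_ge0 ?(ltW e0)// => h.
  by rewrite ltr_norml; have := powR_ge0 x r; lra.
have lb : (y - e) `^ r^-1 < c.
  apply: lt_of; rewrite ?powR_ge0// powRK ?subr_ge0// -/y; lra.
exists (Num.min ((y + e) `^ r^-1 - c) (c - (y - e) `^ r^-1)).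
  by rewrite lt_min !subr_gt0 ub.
move=> x x0; rewrite lt_min => /andP[]; rewrite !ltr_norml => h1 h2.
have x1 : x < (y + e) `^ r^-1 by lra.
have x2 : (y - e) `^ r^-1 < x by lra.
have := mono _ _ x0 x1; rewrite powRK ?addr_ge0 ?(ltW e0)// => h.
have := mono _ _ (powR_ge0 _ _) x2; rewrite powRK ?subr_ge0// => h'; lra.
Qed.

Lemma powR_cvg (r : R) (I : Type) (F : set_system I) (FF : Filter F) (f : I -> R)
    (c : R) : 0 < r -> 0 <= c -> (forall x, 0 <= f x) -> f @ F --> c ->
  (fun x => f x `^ r) @ F --> c `^ r.
Proof.
move=> r0 c0 f0 fc; apply/cvgrPdist_lt => e e0.
have [d d0 dP] := powR_near r0 c0 e0.
move/cvgrPdist_lt: fc => /(_ d d0); apply: filterS => x; exact: dP.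
Qed.

End PowRContinuity.

Section Variation.
Context {R : realType} (phi : R -> R -> R).

(** The sum of [phi] over the intervals of the partition [s :: D]. *)
Fixpoint psum (s : R) (D : seq R) : R :=
  if D is x :: D' then phi s x + psum x D' else 0.

Lemma psumE s t D :
  \sum_(0 <= i < size D) phi (nth t (s :: D) i) (nth t (s :: D) i.+1) = psum s D.
Proof.
elim: D s => [|x D IH] s /=; first by rewrite big_geq.
by rewrite big_nat_recl//= -(IH x).
Qed.

Lemma psum_cat s D1 D2 : psum s (D1 ++ D2) = psum s D1 + psum (last s D1) D2.
Proof. by elim: D1 s => [|x D1 IH] s /=; rewrite ?add0r// IH addrA. Qed.

(** The cell of a partition that contains [t]. *)
Lemma partition_split (s t : R) D : path <%R s D -> s <= t -> t < last s D ->
  exists D1 b D2, [/\ D = D1 ++ b :: D2, last s D1 <= t & t < b].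
Proof.
elim: D s => [|x D IH] s /=; first by move=> _ st /(le_lt_trans st); rewrite ltxx.
case/andP => sx xD st tl; have [tx|xt] := ltP t x; first by exists [::], x, D.
have [D1 [b [D2 [-> h1 h2]]]] := IH x xD xt tl.
by exists (x :: D1), b, D2.
Qed.

(** The supremum of the sums of [phi] over the partitions of [s, t]. *)
Definition vsum (s t : R) : R := sup [set psum s D | D in itv_partition s t].

Context (T M : R).
Hypothesis T0 : 0 <= T.
Hypothesis phi0 : forall s t, 0 <= s -> s <= t -> t <= T -> 0 <= phi s t.
Hypothesis phixx : forall t, 0 <= t -> t <= T -> phi t t = 0.
Hypothesis phiM : forall D, itv_partition 0 T D -> psum 0 D <= M.

Lemma partition_exists (s t : R) : s <= t -> exists D, itv_partition s t D.
Proof.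
rewrite le_eqVlt => /orP[/eqP ->|st]; first by exists [::]; split => /=.
by exists [:: t]; exact: itv_partition1.
Qed.

Lemma psum_ge0 s t D : 0 <= s -> t <= T -> itv_partition s t D -> 0 <= psum s D.
Proof.
elim: D s => [|x D IH] s //= s0 tT sD.
have xD := itv_partition_cons sD; have xt := itv_partition_le xD.
case: sD => /= /andP[sx _] _.
by rewrite addr_ge0 ?phi0 ?IH// ?(ltW sx)// ?(le_trans xt)// (le_trans s0)// ltW.
Qed.

Lemma psum_bounded s t D : 0 <= s -> t <= T -> itv_partition s t D -> psum s D <= M.
Proof.
move=> s0 tT sD; have [D1 sD1] := partition_exists s0.
have [D2 sD2] := partition_exists tT.
apply: le_trans (phiM (itv_partition_cat sD1 (itv_partition_cat sD sD2))).
rewrite !psum_cat; case: (sD1) => _ /eqP ->; case: (sD) => _ /eqP ->.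
have st := itv_partition_le sD.
have h1 := psum_ge0 (lexx 0) (le_trans st tT) sD1.
have h2 := psum_ge0 (le_trans s0 st) (lexx T) sD2.
lra.
Qed.

Lemma has_sup_psum s t : 0 <= s -> s <= t -> t <= T ->
  has_sup [set psum s D | D in itv_partition s t].
Proof.
move=> s0 st tT; split.
  by have [D sD] := partition_exists st; exists (psum s D), D.
by exists M => _ [D sD <-]; exact: (psum_bounded s0 tT).
Qed.

Lemma psum_le_vsum s t D : 0 <= s -> t <= T -> itv_partition s t D ->
  psum s D <= vsum s t.
Proof.
move=> s0 tT sD; apply: ub_le_sup; last by exists D.
by case: (has_sup_psum s0 (itv_partition_le sD) tT).
Qed.

Lemma vsum_le s t B : 0 <= s -> s <= t -> t <= T ->
  (forall D, itv_partition s t D -> psum s D <= B) -> vsum s t <= B.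
Proof.
move=> s0 st tT h; apply: ge_sup; first by case: (has_sup_psum s0 st tT).
by move=> _ [D sD <-]; exact: h.
Qed.

Lemma vsum_approx s t e : 0 <= s -> s <= t -> t <= T -> 0 < e ->
  exists2 D, itv_partition s t D & vsum s t - e < psum s D.
Proof.
move=> s0 st tT e0; have [_ [D sD <-] h] := sup_adherent e0 (has_sup_psum s0 st tT).
by exists D.
Qed.

Lemma phi_le_vsum s t : 0 <= s -> s <= t -> t <= T -> phi s t <= vsum s t.
Proof.
move=> s0 st tT; move: (st); rewrite le_eqVlt => /orP[/eqP e|st'].
  rewrite {}e in s0 st *; rewrite phixx//.
  by have := @psum_le_vsum t t [::] s0 tT; apply; split => /=.
have := psum_le_vsum s0 tT (itv_partition1 st').
by rewrite /= addr0.
Qed.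

Lemma vsum_ge0 s t : 0 <= s -> s <= t -> t <= T -> 0 <= vsum s t.
Proof. by move=> s0 st tT; rewrite (le_trans (phi0 s0 st tT)) ?phi_le_vsum. Qed.

Lemma vsumD s u t : 0 <= s -> s <= u -> u <= t -> t <= T ->
  vsum s u + vsum u t <= vsum s t.
Proof.
move=> s0 su ut tT; have u0 := le_trans s0 su; have uT := le_trans ut tT.
apply/ler_addgt0Pr => e e0; have e2 : 0 < e / 2 by rewrite divr_gt0.
have [D1 sD1 h1] := vsum_approx s0 su uT e2.
have [D2 sD2 h2] := vsum_approx u0 ut tT e2.
have := psum_le_vsum s0 tT (itv_partition_cat sD1 sD2).
rewrite psum_cat; case: (sD1) => _ /eqP ->; lra.
Qed.

Lemma vsum_mono s t t' : 0 <= s -> s <= t -> t <= t' -> t' <= T ->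
  vsum s t <= vsum s t'.
Proof.
move=> s0 st tt' t'T; have := vsumD s0 st tt' t'T.
have := vsum_ge0 (le_trans s0 st) tt' t'T; lra.
Qed.

(** Continuity of [phi] in its second argument, uniformly in the first. *)
Hypothesis phi_unif : forall t e, 0 <= t -> t <= T -> 0 < e -> exists2 d, 0 < d &
  forall a b, 0 <= a -> a <= T -> 0 <= b -> b <= T -> `|b - t| < d ->
    `|phi a b - phi a t| < e.

(** Left continuity: move the last point of a nearly optimal partition of [0, t]
    to the left. *)
Lemma vsum_left t e : 0 <= t -> t <= T -> 0 < e -> exists2 d, 0 < d &
  forall u, 0 <= u -> u <= t -> t - u < d -> vsum 0 t - vsum 0 u < e.
Proof.
move=> t0 tT e0; have e2 : 0 < e / 2 by rewrite divr_gt0.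
move: (t0); rewrite le_eqVlt => /orP[/eqP tt|t0'].
  exists 1 => // u u0; rewrite -tt => ut _.
  have -> : u = 0 by apply/eqP; rewrite eq_le u0 ut.
  by rewrite subrr.
have [D sD h] := vsum_approx (lexx 0) t0 tT e2.
case/lastP: D sD h => [|D x] sD h.
  by move/itv_partition_nil: sD t0' => <-; rewrite ltxx.
case: sD => + /eqP; rewrite last_rcons rcons_path => /andP[pD at'] xt.
rewrite {}xt in at' h; set a := last 0 D in at'.
have [d d0 dP] := phi_unif t0 tT e2.
have aD : itv_partition 0 a D by split.
have a0 := itv_partition_le aD.
exists (Num.min d (t - a)); first by rewrite lt_min d0 subr_gt0.
move=> u u0 ut; rewrite lt_min => /andP[tu1 tu2].
have au : a < u by lra.
have uT := le_trans ut tT.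
have h1 := psum_le_vsum (lexx 0) uT (itv_partition_cat aD (itv_partition1 au)).
have := dP a u a0 (ltW (lt_le_trans au uT)) u0 uT.
rewrite ltr_norml ltr_norml => /(_ ltac:(lra)).
move: h h1; rewrite -cats1 !psum_cat /= -/a; lra.
Qed.

(** Right continuity. A nearly optimal partition of [0, u], with [u] close to
    [t], can be cut at [t] at little cost up to the end [b] of the cell of [t];
    what remains is at most [vsum b u], and this is small because [vsum 0 b] and
    [vsum 0 u] are both close to the limit [L] from the right. *)
Lemma vsum_right t e : 0 <= t -> t < T -> 0 < e -> exists2 d, 0 < d &
  forall u, u <= T -> t <= u -> u - t < d -> vsum 0 u - vsum 0 t < e.
Proof.
move=> t0 tT e0.
pose L := inf [set vsum 0 u | u in [set u | t < u <= T]].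
have hinf : has_inf [set vsum 0 u | u in [set u | t < u <= T]].
  split; first by exists (vsum 0 T), T => //=; rewrite tT lexx.
  exists 0 => _ [u /= /andP[tu uT] <-]; apply: vsum_ge0 => //.
  exact: le_trans (ltW tu).
have LP u : t < u -> u <= T -> L <= vsum 0 u.
  by move=> tu uT; apply: ge_inf; [case: hinf|exists u => //=; rewrite tu uT].
have LW : L <= vsum 0 t.
  apply/ler_addgt0Pr => e' e'0; have e3 : 0 < e' / 3 by rewrite divr_gt0.
  have [d d0 dP] := phi_unif t0 (ltW tT) e3.
  have [_ [u0 /= /andP[tu0 u0T] <-] hu0] := inf_adherent e3 hinf.
  rewrite -/L in hu0.
  pose u := Num.min u0 (t + d / 2).
  have tu : t < u by rewrite /u lt_min tu0 ltrDl divr_gt0.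
  have uu0 : u <= u0 by rewrite /u ge_min lexx.
  have ud : u <= t + d / 2 by rewrite /u ge_min lexx orbT.
  have uT := le_trans uu0 u0T; have u0' := le_trans t0 (ltW tu).
  have hu := vsum_mono (lexx 0) u0' uu0 u0T.
  have [D uD hD] := vsum_approx (lexx 0) u0' uT e3.
  have [pD /eqP lD] := uD.
  have tl : t < last 0 D by rewrite lD.
  have [D1 [b [D2 [DE a1 tb]]]] := partition_split pD t0 tl.
  set a := last 0 D1 in a1.
  move: pD; rewrite DE cat_path /= => /and3P[pD1 ab pD2].
  have lD2 : last b D2 = u by rewrite -lD DE last_cat.
  have aD1 : itv_partition 0 a D1 by split.
  have bD2 : itv_partition b u D2 by split=> //; rewrite lD2.
  have a0 := itv_partition_le aD1; have bu := itv_partition_le bD2.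
  have b0 : 0 <= b by exact: le_trans t0 (ltW tb).
  have bT := le_trans bu uT.
  have h1 : psum 0 D1 + phi a t <= vsum 0 t.
    apply: le_trans (vsumD (lexx 0) a0 a1 (ltW tT)); apply: lerD.
      exact: psum_le_vsum (lexx 0) (le_trans a1 (ltW tT)) aD1.
    exact: phi_le_vsum a0 a1 (ltW tT).
  have h2 := psum_le_vsum b0 uT bD2.
  have h3 := vsumD (lexx 0) b0 bu uT.
  have h4 := LP b tb bT.
  have := dP a b a0 (le_trans a1 (ltW tT)) b0 bT.
  rewrite !ltr_norml => /(_ ltac:(lra)).
  by move: hD; rewrite DE psum_cat /= -/a; lra.
have [_ [u0 /= /andP[tu0 u0T] <-] hu0] := inf_adherent e0 hinf.
rewrite -/L in hu0; exists (u0 - t); first by rewrite subr_gt0.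
move=> u uT tu uu0; have uu0' : u <= u0 by lra.
have := vsum_mono (lexx 0) (le_trans t0 tu) uu0' u0T; lra.
Qed.

Lemma vsum_near t e : 0 <= t -> t <= T -> 0 < e -> exists2 d, 0 < d &
  forall u, 0 <= u -> u <= T -> `|u - t| < d -> `|vsum 0 u - vsum 0 t| < e.
Proof.
move=> t0 tT e0; have [d1 d10 d1P] := vsum_left t0 tT e0.
have [d2 d20 d2P] : exists2 d, 0 < d & forall u, u <= T -> t <= u -> u - t < d ->
    vsum 0 u - vsum 0 t < e.
  move: (tT); rewrite le_eqVlt => /orP[/eqP tT'|tT']; last exact: vsum_right.
  exists 1 => // u uT tu _; have -> : u = t by apply/eqP; rewrite eq_le tu tT' uT.
  by rewrite subrr.
exists (Num.min d1 d2); first by rewrite lt_min d10.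
move=> u u0 uT; rewrite lt_min !ltr_norml => /andP[h1 h2].
have [ut|tu] := leP u t.
  have := d1P u u0 ut; have := vsum_mono (lexx 0) u0 ut tT; lra.
have := d2P u uT (ltW tu); have := vsum_mono (lexx 0) t0 (ltW tu) uT; lra.
Qed.

Lemma vsum_unif e : 0 < e -> exists2 d, 0 < d & forall s t, 0 <= s -> s <= t ->
  t <= T -> t - s < d -> vsum 0 t - vsum 0 s < e.
Proof.
move=> e0; have /compact_near_coveringP/near_covering_withinP := @segment_compact R 0 T.
have FF : Filter (0 : R)^'+ by exact: at_right_proper_filter.
move=> /(_ R (0 : R)^'+ (fun d s => forall t, s <= t -> t <= T -> t - s < d ->
  vsum 0 t - vsum 0 s < e) FF) h.
have {}h : \forall d \near (0 : R)^'+, `[0, T] `<=`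
    (fun s => forall t, s <= t -> t <= T -> t - s < d -> vsum 0 t - vsum 0 s < e).
  apply: h => x; rewrite /= in_itv /= => /andP[x0 xT].
  have e2 : 0 < e / 2 by rewrite divr_gt0.
  have [d d0 dP] := vsum_near x0 xT e2.
  have d2 : 0 < d / 2 by rewrite divr_gt0.
  near=> s d'; rewrite /= in_itv /= => /andP[s0 sT] t st tT tsd.
  have h1 : `|s - x| < d / 2.
    by near: s; apply/nbhs_ballP; exists (d / 2) => //= y; rewrite /ball /= distrC.
  have h2 : d' < d / 2 by near: d'; exact: nbhs_right_lt.
  have := dP s s0 sT; have := dP t (le_trans s0 st) tT.
  by move: h1; rewrite !ltr_norml; lra.
near ((0 : R)^'+) => d.
have dP : `[0, T] `<=` (fun s => forall t, s <= t -> t <= T -> t - s < d ->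
    vsum 0 t - vsum 0 s < e) by near: d.
exists d; first by near: d; exact: nbhs_right_gt.
move=> s t s0 st tT; apply: dP => //.
by rewrite /= in_itv /= s0 (le_trans st).
Unshelve. all: by end_near.
Qed.

End Variation.

(** * Paths of finite p-variation *)

(** The nearest point of [0, T]. *)
Definition clip {R : realType} (T t : R) : R := Num.max 0 (Num.min t T).

Section Clip.
Context {R : realType} (T : R).
Hypothesis T0 : 0 <= T.

Lemma clip_ge0 t : 0 <= clip T t.
Proof. by rewrite /clip le_max lexx. Qed.

Lemma clip_le t : clip T t <= T.
Proof. by rewrite /clip ge_max T0 ge_min lexx orbT. Qed.

Lemma clip_id t : 0 <= t -> t <= T -> clip T t = t.
Proof. by move=> t0 tT; rewrite /clip min_l// max_r. Qed.

Lemma clip_lip s t : `|clip T s - clip T t| <= `|s - t|.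
Proof.
have cE u : [\/ (u < 0 /\ u <= T) /\ clip T u = 0,
    (0 <= u /\ u <= T) /\ clip T u = u | (0 <= u /\ T < u) /\ clip T u = T].
  have [u0|u0] := ltP u 0.
    have uT : u <= T by exact: le_trans (ltW u0) T0.
    by apply: Or31; split => //; rewrite /clip min_l// max_l// ltW.
  have [uT|uT] := leP u T; first by apply: Or32; rewrite clip_id.
  by apply: Or33; split => //; rewrite /clip min_r ?ltW// max_r.
have h1 := ler_norm (s - t); have := ler_norm (t - s); rewrite distrC => h2.
by case: (cE s) => -[[? ?] ->]; case: (cE t) => -[[? ?] ->];
   rewrite ler_norml; apply/andP; split; move: T0; lra.
Qed.

Lemma clip_cvg t : clip T s @[s --> t] --> clip T t.
Proof.
apply/cvgrPdist_lt => e e0; near=> s; apply: (le_lt_trans (clip_lip _ _)).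
near: s; apply/nbhs_ballP; exists e => // s; by rewrite /ball.
Unshelve. all: by end_near.
Qed.

Lemma within_clip (Y : normedModType R) (g : R -> Y) :
  {within `[0, T], continuous g} -> forall t, g (clip T s) @[s --> t] --> g (clip T t).
Proof.
move=> /subspace_continuousP gc t B nB.
have cT : `[0, T]%classic (clip T t) by rewrite /= in_itv /= clip_ge0 clip_le.
have h : \forall s \near t, `[0, T]%classic (clip T s) -> B (g (clip T s)).
  exact: (@clip_cvg t _ (gc (clip T t) cT B nB)).
suff : \forall s \near t, B (g (clip T s)) by [].
by apply: filterS h => s; apply; rewrite /= in_itv /= clip_ge0 clip_le.
Qed.

End Clip.

Lemma sum_const_seq (R : nzRingType) (J : Type) (r : seq J) (c : R) :
  \sum_(j <- r) c = (size r)%:R * c.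
Proof. by rewrite big_const_seq count_predT iter_addr_0 mulr_natl. Qed.

Section TriplePaths.
Context {R : realType} {V : completeNormedModType R} (W : tensor_powers V).
Context {S : eqType} (deg : S -> nat) (n : nat) (X : triple W deg n).

Lemma act_bounded : exists2 kap : R, 0 <= kap &
  forall s, s \in symb X -> forall a, `|act X s a| <= kap * `|a|.
Proof.
elim: (symb X) => [|s l [kap k0 kP]]; first by exists 0.
have := @continuous_linear_bounded _ _ _ 0 (act X s) (@clin_continuous _ _ _ (act X s) 0).
move=> /linear_boundedP [r [rreal rP]].
pose r' := Num.max kap (r + 1).
exists r'; first by rewrite le_max k0.
move=> u; rewrite inE => /orP[/eqP ->|ul] a.
  apply: (le_trans (rP (r + 1) _ a)); first by rewrite ltrDl.
  by rewrite ler_wpM2r// le_max lexx orbT.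
by rewrite (le_trans (kP u ul a))// ler_wpM2r// le_max lexx.
Qed.

Lemma hnorm_ge0 (a : X) : 0 <= hnorm a.
Proof. by apply: sumr_ge0 => s _; exact: powR_ge0. Qed.

Lemma act_le_hnorm s (a : X) : s \in symb X -> (1 <= deg s)%N ->
  `|act X s a| <= hnorm a ^+ deg s.
Proof.
move=> sX d1; have dn0 : (deg s)%:R != 0 :> R by rewrite pnatr_eq0 -lt0n.
rewrite -powR_mulrn ?hnorm_ge0// -[leLHS](@powRK R _ (deg s)%:R)//.
apply: powR_mono; rewrite ?powR_ge0//.
rewrite /hnorm (big_rem s)//= d1 lerDl; apply: sumr_ge0 => t _.
exact: powR_ge0.
Qed.

Lemma gpart_le_hnorm k (a : X) : (0 < k <= n)%N ->
  `|gpart k a| <= (size (symb X))%:R * hnorm a ^+ k.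
Proof.
case/andP => k0 kn; rewrite gpart_act//; apply: (le_trans (ler_norm_sum _ _ _)).
rewrite -sum_const_seq big_mkcond /=.
rewrite big_seq_cond [leRHS]big_seq_cond; apply: ler_sum => s; rewrite andbT => sX.
case: eqP => [sk|_]; last by rewrite exprn_ge0// hnorm_ge0.
rewrite norm_inj ?sk// -[in leRHS]sk; apply: act_le_hnorm => //.
by rewrite sk.
Qed.

(** Homogeneous bounds on the components are bounds on [hnorm]. *)
Lemma hnorm_le C : 0 <= C -> exists2 K, 0 <= K & forall (a : X) r, 0 <= r ->
  (forall k, (0 < k <= n)%N -> `|gpart k a| <= C * r ^+ k) -> hnorm a <= K * r.
Proof.
move=> C0; have [kap kap0 kapP] := act_bounded.
pose D := Num.max 1 (kap * C); have D1 : 1 <= D by rewrite le_max lexx.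
have D0 : 0 <= D by exact: le_trans ler01 D1.
exists ((size (symb X))%:R * D); first by rewrite mulr_ge0.
move=> a r r0 H; rewrite -mulrA -sum_const_seq /hnorm big_mkcond /=.
rewrite big_seq_cond [leRHS]big_seq_cond; apply: ler_sum => s; rewrite andbT => sX.
case: ifP => [d1|_]; last by rewrite mulr_ge0.
have dn0 : (deg s)%:R != 0 :> R by rewrite pnatr_eq0 -lt0n.
have Dr0 : 0 <= D * r by rewrite mulr_ge0.
have -> : D * r = ((D * r) `^ (deg s)%:R) `^ (deg s)%:R^-1.
  by rewrite -powRrM mulfV// powRr1.
apply: powR_mono; rewrite ?invr_ge0// powR_mulrn//.
rewrite act_gpart//; apply: (le_trans (kapP s sX _)).
have dsn : (0 < deg s <= n)%N by rewrite d1 (symb_deg sX).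
apply: (@le_trans _ _ (kap * (C * r ^+ deg s))); first by rewrite ler_wpM2l// H.
rewrite mulrA exprMn ler_wpM2r ?exprn_ge0//.
apply: (@le_trans _ _ D); first by rewrite le_max lexx orbT.
by rewrite -[leLHS]expr1 ler_weXn2l.
Qed.

Lemma act_cvg s (I : Type) (F : set_system I) (FF : Filter F) (f : I -> X) (a : X) :
  f @ F --> a -> (fun x => `|act X s (f x)|) @ F --> `|act X s a|.
Proof.
move=> fa; apply: cvg_norm; apply: (cvg_comp _ _ fa).
exact: (@clin_continuous _ _ _ (act X s)).
Qed.

Lemma hnorm_cvg (I : Type) (F : set_system I) (FF : Filter F) (f : I -> X) (a : X) :
  f @ F --> a -> (fun x => hnorm (f x)) @ F --> hnorm a.
Proof.
move=> fa; rewrite /hnorm.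
elim: (symb X) => [|s l IH].
  by under eq_fun do rewrite big_nil; rewrite big_nil; exact: cvg_cst.
under eq_fun do rewrite big_cons; rewrite big_cons; case: ifP => [d1|] //.
apply: cvgD => //; apply: powR_cvg => //; last exact: act_cvg.
by rewrite invr_gt0 ltr0n.
Qed.

Context (p : R) (p1 : 1 <= p).
Let p0 : 0 < p := lt_le_trans ltr01 p1.

(** The [p]-th power of the size of the increment of [g] over [s, t]. *)
Definition incr_pow (g : R -> X) (s t : R) : R := hnorm (incr g s t) `^ p.

Lemma hnorm1 : hnorm (1 : X) = 0.
Proof.
rewrite /hnorm big_seq_cond big1// => s /andP[sX d1].
rewrite act_gpart// gpart1 ?d1 ?(symb_deg sX)// linear0 normr0 powR0//.
by rewrite invr_eq0 pnatr_eq0 -lt0n.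
Qed.

Lemma incr_pow_ge0 g s t : 0 <= incr_pow g s t.
Proof. exact: powR_ge0. Qed.

Section Path.
Context (T : R) (g : R -> X).
Hypothesis T0 : 0 <= T.
Hypothesis gp : cpvar_path p T g.

Lemma path_ugrp t : 0 <= t -> t <= T -> ugrp X (g t).
Proof. by case: gp => gG _ _ t0 tT; apply: gG; rewrite t0 tT. Qed.

Lemma incr_id t : 0 <= t -> t <= T -> incr g t t = 1.
Proof. by move=> t0 tT; rewrite /incr mulVr//; exact/ugrp_unit/path_ugrp. Qed.

Lemma incr_powxx t : 0 <= t -> t <= T -> incr_pow g t t = 0.
Proof. by move=> t0 tT; rewrite /incr_pow incr_id// hnorm1 powR0 ?gt_eqF. Qed.

Lemma psum_le_pvar s t D : itv_partition s t D ->
  ((psum (incr_pow g) s D `^ p^-1)%:E <= pvar p g s t)%E.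
Proof.
by move=> sD; apply: ereal_sup_ubound; exists D => //; rewrite -(psumE _ s t).
Qed.

Lemma psum_le s t D q : pvar p g s t = q%:E -> itv_partition s t D -> 
  0 <= psum (incr_pow g) s D -> psum (incr_pow g) s D <= q `^ p.
Proof.
move=> pq sD s0; have := psum_le_pvar sD; rewrite pq lee_fin => h.
rewrite -[leLHS](@powRK R _ p^-1) ?invr_eq0 ?gt_eqF// invrK powRAC.
by apply: powR_mono => //; rewrite ?powR_ge0// ltW.
Qed.

Lemma psum_incr_ge0 s D : 0 <= psum (incr_pow g) s D.
Proof. by elim: D s => //= x D IH s; rewrite addr_ge0 ?incr_pow_ge0. Qed.

Lemma pvar_ge0 s t : s <= t -> (0 <= pvar p g s t)%E.
Proof.
move=> st; have [D sD] := partition_exists st.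
by apply: le_trans (psum_le_pvar sD); rewrite lee_fin powR_ge0.
Qed.

Lemma incr_pow_bounded : exists M, forall D, itv_partition 0 T D ->
  psum (incr_pow g) 0 D <= M.
Proof.
case: gp => _ _ gfin; exists (fine (pvar p g 0 T) `^ p) => D sD.
apply: (psum_le _ sD (psum_incr_ge0 _ _)); rewrite fineK// ge0_fin_numE//.
exact: pvar_ge0.
Qed.

(** Joint continuity and compactness of [0, T] give the uniformity in [a]. *)
Lemma incr_pow_unif t e : 0 <= t -> t <= T -> 0 < e -> exists2 d, 0 < d &
  forall a b, 0 <= a -> a <= T -> 0 <= b -> b <= T -> `|b - t| < d ->
    `|incr_pow g a b - incr_pow g a t| < e.
Proof.
move=> t0 tT e0; case: gp => gG gc _.
pose f (x : R * R) : R := hnorm (tinv (g (clip T x.1)) * g (clip T x.2)) `^ p.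
have fE a b : 0 <= a -> a <= T -> 0 <= b -> b <= T -> incr_pow g a b = f (a, b).
  move=> a0 aT b0 bT; rewrite /f /incr_pow /incr (clip_id a0 aT) (clip_id b0 bT).
  by rewrite (ugrp_invE (path_ugrp a0 aT)).
pose q (y : R * R) : X := tinv (g (clip T y.1)) * g (clip T y.2).
have qc (x : R * R) : q y @[y --> x] --> q x.
  apply: banach_cvgM.
    apply: tinv_cvg; apply: (cvg_comp fst (fun s => g (clip T s)) cvg_fst).
    exact: within_clip.
  apply: (cvg_comp snd (fun s => g (clip T s)) cvg_snd); exact: within_clip.
have fc (x : R * R) : f y @[y --> x] --> f x.
  have hc := hnorm_cvg _ (qc x).
  exact: (powR_cvg _ p0 (hnorm_ge0 (q x)) (fun y => hnorm_ge0 (q y)) (hc _)).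
clearbody f; clear q qc.
have /compact_near_coveringP h := @segment_compact R 0 T.
have {}h : \forall b \near t, `[0, T] `<=` (fun a => `|f (a, b) - f (a, t)| < e).
  apply: (h R (nbhs t) (fun b a => `|f (a, b) - f (a, t)| < e)) => a _.
  have e2 : 0 < e / 2 by rewrite divr_gt0.
  have /cvgrPdist_lt/(_ _ e2) [[A B] /= [nA nB] AB] := fc (a, t).
  exists (A, B) => // -[a' b] /= [Aa' Bb].
  have h1 := AB (a', b) (conj Aa' Bb).
  have h2 := AB (a', t) (conj Aa' (nbhs_singleton nB)).
  by move: h1 h2; rewrite !ltr_norml; lra.
move/nbhs_ballP: h => [d /= d0 dP]; exists d => // a b a0 aT b0 bT bt.
rewrite !fE//; apply: (dP b); first by rewrite /ball /= distrC.
by rewrite /= in_itv /= a0 aT.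
Qed.

Let phi := incr_pow g.
(** The smallest superadditive function dominating the [p]-th powers. *)
Definition pcontrol (s t : R) : R := vsum (incr_pow g) s t.

Let phi0 s t : 0 <= s -> s <= t -> t <= T -> 0 <= phi s t.
Proof. by move=> *; exact: incr_pow_ge0. Qed.

Lemma pcontrol_ge0 s t : 0 <= s -> s <= t -> t <= T -> 0 <= pcontrol s t.
Proof. have [M HM] := incr_pow_bounded; exact: (vsum_ge0 phi0 incr_powxx HM). Qed.

Lemma pcontrolD s u t : 0 <= s -> s <= u -> u <= t -> t <= T ->
  pcontrol s u + pcontrol u t <= pcontrol s t.
Proof. have [M HM] := incr_pow_bounded; exact: (vsumD phi0 HM). Qed.

Lemma pcontrol_unif e : 0 < e -> exists2 d, 0 < d & forall s t, 0 <= s -> s <= t ->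
  t <= T -> t - s < d -> pcontrol 0 t - pcontrol 0 s < e.
Proof.
have [M HM] := incr_pow_bounded.
exact: (vsum_unif phi0 incr_powxx HM incr_pow_unif).
Qed.

Lemma pcontrol_mono s t : 0 <= s -> s <= t -> t <= T -> pcontrol 0 s <= pcontrol 0 t.
Proof.
move=> s0 st tT; have := pcontrolD (lexx 0) s0 st tT.
have := pcontrol_ge0 s0 st tT; lra.
Qed.

Lemma fine_pcontrol : fine_control T pcontrol.
Proof.
split; [exact: pcontrol_ge0|exact: pcontrolD|move=> e /pcontrol_unif[d d0 dP]].
exists d => // s t s0 st tT ts; have := dP s t s0 st tT ts.
have := pcontrolD (lexx 0) s0 st tT; lra.
Qed.

Lemma hnorm_le_pcontrol s t : 0 <= s -> s <= t -> t <= T ->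
  hnorm (incr g s t) <= pcontrol s t `^ p^-1.
Proof.
move=> s0 st tT; have [M HM] := incr_pow_bounded.
rewrite -[leLHS](@powRK R _ p^-1) ?invr_eq0 ?gt_eqF ?hnorm_ge0// invrK.
apply: powR_mono; rewrite ?powR_ge0// ?invr_ge0 ?(ltW p0)//.
exact: (phi_le_vsum phi0 incr_powxx HM).
Qed.

Lemma pcontrol_le_pvar s t : 0 <= s -> s <= t -> t <= T ->
  ((pcontrol s t `^ p^-1)%:E <= pvar p g s t)%E.
Proof.
move=> s0 st tT; have := pvar_ge0 st; case E : (pvar p g s t) => [q| |] // q0.
  rewrite lee_fin; rewrite lee_fin in q0.
  rewrite -[leRHS](@powRK R _ p^-1) ?invr_eq0 ?gt_eqF// invrK.
  apply: powR_mono; rewrite ?invr_ge0 ?(ltW p0) ?pcontrol_ge0//.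
  have [M HM] := incr_pow_bounded.
  apply: (vsum_le phi0 HM) => // D sD; exact: (psum_le E sD (psum_incr_ge0 _ _)).
by rewrite leey.
Qed.

End Path.

(** Increments bounded by a superadditive function bound the p-variation. *)
Lemma pvar_le T (w : R -> R -> R) (h : R -> X) K s t : 0 <= K ->
  (forall s t, 0 <= s -> s <= t -> t <= T -> 0 <= w s t) ->
  (forall s u t, 0 <= s -> s <= u -> u <= t -> t <= T -> w s u + w u t <= w s t) ->
  (forall s t, 0 <= s -> s <= t -> t <= T ->
     hnorm (incr h s t) <= K * w s t `^ p^-1) ->
  0 <= s -> s <= t -> t <= T ->
  (pvar p h s t <= (K * w s t `^ p^-1)%:E)%E.
Proof.
move=> K0 w0 wD H s0 st tT; apply: ge_ereal_sup => _ [D sD <-].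
rewrite (psumE (incr_pow h)) lee_fin.
have Kp : K = (K `^ p) `^ p^-1 by rewrite -powRrM mulfV ?gt_eqF// powRr1.
rewrite Kp -powRM ?powR_ge0 ?w0//.
apply: powR_mono; rewrite ?invr_ge0 ?(ltW p0)//.
  by elim: D {sD} s {s0 st} => //= x D IH s; rewrite addr_ge0 ?incr_pow_ge0.
elim: D s s0 st sD => [|x D IH] s s0 st sD /=.
  by rewrite mulr_ge0 ?powR_ge0 ?w0.
have xD := itv_partition_cons sD; have xt := itv_partition_le xD.
case: sD => /= /andP[sx _] _.
have x0 : 0 <= x by exact: le_trans (ltW sx).
apply: (@le_trans _ _ (K `^ p * (w s x + w x t))); last first.
  by rewrite ler_wpM2l ?powR_ge0// wD// ltW.
rewrite mulrDr; apply: lerD; last exact: IH.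
have xT := le_trans xt tT.
have := H s x s0 (ltW sx) xT; rewrite /incr_pow => h1.
apply: (le_trans (powR_mono (ltW p0) (hnorm_ge0 _) h1)).
by rewrite powRM ?powR_ge0// powRK ?gt_eqF// w0// ltW.
Qed.

End TriplePaths.

(** * Truncation and its section *)

Section Truncation.
Context {R : realType} {V : completeNormedModType R} (W : tensor_powers V).
Context {S : eqType} (deg : S -> nat) (F : forall n, triple W deg n).
Context (Fc : consistent F) (N n : nat) (N1 : (1 <= N)%N) (Nn : (N <= n)%N).
Local Notation X := (F n).
Local Notation Y := (F N).

Let NN : (1 <= N <= n)%N. Proof. by rewrite N1. Qed.

Local Notation tr := (@trunc R V W S deg n N X Y).

Lemma symb_trunc : perm_eq (symb Y) [seq s <- symb X | (deg s <= N)%N].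
Proof.
apply: uniq_perm; [exact: symb_uniq|exact/filter_uniq/symb_uniq|move=> s].
by rewrite mem_filter (consistent_symb Fc NN) andbC.
Qed.

Lemma proj_inj_deg k d (w : tpow W d) : (k <= N)%N -> d = k ->
  inj Y k (proj X k (inj X d w)) = inj Y d w.
Proof. by move=> + e; case: k / e => kN; rewrite injK//; exact: leq_trans kN Nn. Qed.

(** Truncation keeps the components of degree at most [N]. *)
Lemma truncE (a : X) : tr a = \sum_(k < N.+1) inj Y k (proj X k a).
Proof.
rewrite /trunc (perm_big _ symb_trunc) big_filter.
transitivity (\sum_(k < N.+1) \sum_(s <- symb X | deg s == k)
    inj Y _ (act X s a)); last first.
  apply: eq_bigr => k _; have kN : (k <= N)%N by exact: leq_ord.
  have kn := leq_trans kN Nn.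
  rewrite -(proj_gpart a kn) (gpart_act a kn) !linear_sum.
  by apply: eq_bigr => s /eqP sk; rewrite (proj_inj_deg (act X s a) kN sk).
rewrite (exchange_big_dep xpredT)//= big_mkcond; apply: eq_bigr => s _.
case: leqP => sN; last first.
  rewrite big_pred0// => k; apply/negbTE; rewrite neq_ltn.
  by rewrite (leq_trans (ltn_ord k) sN) orbT.
by rewrite (big_pred1 (Ordinal (sN : (deg s < N.+1)%N)))// => k; rewrite eq_sym.
Qed.

Lemma proj_trunc k (a : X) : (k <= N)%N -> proj Y k (tr a) = proj X k a.
Proof.
move=> kN; rewrite truncE linear_sum (bigD1 (Ordinal (kN : (k < N.+1)%N)))//=.
rewrite injK// big1 ?addr0// => i ik; rewrite proj_inj ?leq_ord// eq_sym.
exact: ik.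
Qed.

Lemma norm_gpart_trunc k (a : X) : (k <= N)%N -> `|gpart k (tr a)| = `|gpart k a|.
Proof.
by move=> kN; rewrite /gpart proj_trunc// !norm_inj// (leq_trans kN).
Qed.

Lemma trunc_gpart k (a b : X) : (k <= N)%N -> tr a = tr b -> gpart k a = gpart k b.
Proof. by move=> kN ab; rewrite /gpart -!(proj_trunc _ kN) ab. Qed.

Lemma trunc_eq (a b : X) : (forall k, (k <= N)%N -> gpart k a = gpart k b) -> tr a = tr b.
Proof.
move=> ab; rewrite !truncE; apply: eq_bigr => k _; have kN := leq_ord k.
have kn := leq_trans kN Nn.
by rewrite -[in LHS](proj_gpart a kn) (ab _ kN) (proj_gpart b kn).
Qed.

Lemma trunc_one : tr 1 = 1.
Proof. by case: (consistent_monoid_morphism Fc NN). Qed.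

Lemma trunc_mul (a b : X) : tr (a * b) = tr a * tr b.
Proof. by case: (consistent_monoid_morphism Fc NN). Qed.

Lemma ugrp_trunc (a : X) : ugrp Y (tr a) <-> ugrp X a.
Proof. by rewrite /ugrp /= proj_trunc. Qed.

Lemma trunc_inv (a : X) : ugrp X a -> tr a^-1 = (tr a)^-1.
Proof.
move=> aG; have tG : ugrp Y (tr a) by exact/ugrp_trunc.
apply: (mulrI (ugrp_unit tG)); rewrite mulrV ?ugrp_unit// -trunc_mul mulrV ?ugrp_unit//.
exact: trunc_one.
Qed.

Lemma trunc_incr (h : R -> X) s t : ugrp X (h s) ->
  tr (incr h s t) = incr (fun u => tr (h u)) s t.
Proof. by move=> hs; rewrite /incr trunc_mul trunc_inv. Qed.

Lemma act_trunc s (a : X) : s \in symb Y -> act Y s (tr a) = act X s a.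
Proof. by move=> sY; exact: (consistent_act Fc NN). Qed.

Lemma hnorm_trunc (a : X) : hnorm (tr a) <= hnorm a.
Proof.
rewrite /hnorm big_seq_cond.
under eq_bigr => s /andP[sY _] do rewrite act_trunc//.
rewrite -big_seq_cond (perm_big _ symb_trunc)/= big_filter_cond.
rewrite big_mkcond [leRHS]big_mkcond; apply: ler_sum => s _.
by case: (deg s <= N)%N; case: (0 < deg s)%N => //=; exact: powR_ge0.
Qed.

(** The section of the truncation with no component of degree above [N]. *)
Definition tembed (a : Y) : X := \sum_(k < N.+1) inj X k (proj Y k a).

Lemma tembed_is_linear : linear tembed.
Proof.
move=> c a b; rewrite /tembed scaler_sumr -big_split; apply: eq_bigr => k _.
by rewrite !linearP.
Qed.

HB.instance Definition _ := GRing.isLinear.Build R Y X _ tembed tembed_is_linear.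

Lemma proj_tembed k (a : Y) : (k <= N)%N -> proj X k (tembed a) = proj Y k a.
Proof.
move=> kN; rewrite linear_sum (bigD1 (Ordinal (kN : (k < N.+1)%N)))//=.
have kn := leq_trans kN Nn.
rewrite injK// big1 ?addr0// => i ik.
rewrite proj_inj ?(leq_trans (leq_ord i) Nn)// eq_sym; exact: ik.
Qed.

Lemma gpart_tembed_high k (a : Y) : (N < k <= n)%N -> gpart k (tembed a) = 0.
Proof.
case/andP => Nk kn; rewrite /tembed linear_sum big1// => i _ /=.
rewrite gpart_inj ?(leq_trans (leq_ord i) Nn)//.
by rewrite gtn_eqF// (leq_ltn_trans (leq_ord i)).
Qed.

Lemma tembedK (a : Y) : tr (tembed a) = a.
Proof.
rewrite truncE [RHS]gpart_sum; apply: eq_bigr => k _.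
by rewrite proj_tembed// leq_ord.
Qed.

Lemma ugrp_tembed (a : Y) : ugrp Y a -> ugrp X (tembed a).
Proof. by move=> aG; apply/ugrp_trunc; rewrite tembedK. Qed.

Lemma norm_tembed (a : Y) : `|tembed a| <= `|a|.
Proof.
rewrite [leLHS]gpart_norm [leRHS]gpart_norm (big_ord_widen n.+1 (fun k => `|gpart k a|))//.
rewrite [leRHS]big_mkcond; apply: ler_sum => k _ /=.
case: ltnP => kN; first by rewrite -(norm_gpart_trunc (tembed a))// tembedK.
by rewrite gpart_tembed_high ?normr0// kN leq_ord.
Qed.

Lemma tembed1 : tembed 1 = 1.
Proof.
apply: gpart_ext => k kn; have [kN|Nk] := leqP k N.
  by apply: trunc_gpart => //; rewrite tembedK trunc_one.
by rewrite gpart_tembed_high ?Nk// gpart1// kn (leq_ltn_trans _ Nk).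
Qed.

Lemma hnorm_tembed (a : Y) : hnorm (tembed a) <= hnorm a.
Proof.
rewrite -{2}(tembedK a) /hnorm.
rewrite [leRHS]big_seq_cond.
under [leRHS]eq_bigr => s /andP[sY _] do rewrite act_trunc//.
rewrite -big_seq_cond (perm_big _ symb_trunc)/= big_filter_cond.
rewrite big_seq_cond [leRHS]big_seq_cond big_mkcond [leRHS]big_mkcond /=.
apply: ler_sum => s _; case sX : (s \in symb X) => //=.
have [d1|//] := boolP (0 < deg s)%N; have [sN|sN] := leqP (deg s) N => //=.
have sn : (N < deg s <= n)%N by rewrite sN (symb_deg sX).
rewrite (act_gpart _ sX) (gpart_tembed_high a sn) linear0 normr0.
by rewrite powR0// invr_eq0 pnatr_eq0 -lt0n.
Qed.

End Truncation.

Lemma trunc_trunc (R : realType) (V : completeNormedModType R) (W : tensor_powers V)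
    (S : eqType) (deg : S -> nat) (F : forall n, triple W deg n) (Fc : consistent F)
    (k m n : nat) (a : F n) : (1 <= k)%N -> (k <= m)%N -> (m <= n)%N ->
  trunc (F k) (trunc (F m) a) = trunc (F k) a.
Proof.
move=> k1 km mn; have kn := leq_trans km mn; have m1 := leq_trans k1 km.
rewrite (truncE Fc k1 km) (truncE Fc k1 kn); apply: eq_bigr => i _.
by rewrite (proj_trunc Fc m1 mn)// (leq_trans (leq_ord i)).
Qed.

(** * Lifts of a path *)

Section PathBounds.
Context {R : realType} {V : completeNormedModType R} (W : tensor_powers V).
Context {S : eqType} (deg : S -> nat) (n : nat) (X : triple W deg n).
Context (p : R) (p1 : 1 <= p).
Let p0 : 0 < p := lt_le_trans ltr01 p1.

Lemma level_weaken T (w w' : R -> R -> R) m C C' (h : R -> X) : C <= C' -> 0 <= C' ->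
  (forall s t, 0 <= s -> s <= t -> t <= T -> 0 <= w s t <= w' s t) ->
  level_bound p T w m C h -> level_bound p T w' m C' h.
Proof.
move=> CC' C'0 ww' [hG h0 hC]; split => // s t k s0 st tT km.
have /andP[ws0 wst] := ww' s t s0 st tT.
apply: (le_trans (hC s t k s0 st tT km)).
have r0 : 0 <= w s t `^ p^-1 by exact: powR_ge0.
apply: (@le_trans _ _ (C' * (w s t `^ p^-1) ^+ k)).
  by rewrite ler_wpM2r// exprn_ge0.
rewrite ler_wpM2l// lerXn2r ?nnegrE ?powR_ge0//.
by apply: powR_mono => //; rewrite invr_ge0 ltW.
Qed.

Context (T : R) (T0 : 0 <= T).

(** The additive control carried by a path of finite [p]-variation. *)
Lemma pcontrol_additive (h : R -> X) s t : cpvar_path p T h ->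
  0 <= s -> s <= t -> t <= T ->
  0 <= pcontrol p h s t <= pcontrol p h 0 t - pcontrol p h 0 s.
Proof.
move=> hp s0 st tT; rewrite (pcontrol_ge0 p1 T0 hp)//=.
have := pcontrolD p1 T0 hp (lexx 0) s0 st tT; lra.
Qed.

(** Every path of finite [p]-variation issued from [1] has homogeneous bounds. *)
Lemma cpvar_level (h : R -> X) C : cpvar_path p T h -> h 0 = 1 ->
  (size (symb X))%:R <= C -> level_bound p T (pcontrol p h) n C h.
Proof.
move=> hp h0 hC; split => //; first by move=> t; exact: (path_ugrp hp).
move=> s t k s0 st tT km; apply: (le_trans (gpart_le_hnorm _ km)).
apply: ler_pM; rewrite ?exprn_ge0 ?hnorm_ge0//.
rewrite lerXn2r ?nnegrE ?hnorm_ge0 ?powR_ge0//.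
exact: (hnorm_le_pcontrol p1 T0 hp).
Qed.

Lemma cpvar_level_additive (h : R -> X) C : cpvar_path p T h -> h 0 = 1 ->
  (size (symb X))%:R <= C ->
  level_bound p T (fun s t => pcontrol p h 0 t - pcontrol p h 0 s) n C h.
Proof.
move=> hp h0 hC; apply: (level_weaken (lexx C)) (cpvar_level hp h0 hC).
  exact: le_trans hC.
by move=> s t s0 st tT; exact: pcontrol_additive.
Qed.

Context (v : R -> R) (C : R) (h : R -> X).
Hypothesis C0 : 0 <= C.
Hypothesis v_homo : forall s t, 0 <= s -> s <= t -> t <= T -> v s <= v t.
Hypothesis v_small : forall e, 0 < e -> exists2 d, 0 < d &
  forall s t, 0 <= s -> s <= t -> t <= T -> t - s < d -> v t - v s < e.
Hypothesis hb : level_bound p T (fun s t => v t - v s) n C h.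

Lemma level_unif e : 0 < e -> exists2 d, 0 < d &
  forall s t, 0 <= s -> s <= t -> t <= T -> t - s < d -> `|h t - h s| < e.
Proof.
move=> e0; pose B := level_norm n p T v C.
have B0 : 0 <= B by exact: (level_norm_ge0 p1 T0 C0 v_homo hb).
pose c := B * (n.+1%:R * C); have c0 : 0 <= c by rewrite !mulr_ge0.
pose r1 := Num.min 1 (e / (c + 1)).
have r10 : 0 < r1 by rewrite lt_min ltr01 divr_gt0// ltr_wpDl.
have [d d0 dP] := v_small (powR_gt0 p r10).
exists d => // s t s0 st tT ts.
have t0 := le_trans s0 st; have sT := le_trans st tT.
have Gs := level_ugrp hb s0 sT; have Gt := level_ugrp hb t0 tT.
have om0 : 0 <= v t - v s by rewrite subr_ge0 v_homo.
pose rho := (v t - v s) `^ p^-1.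
have rho0 : 0 <= rho by exact: powR_ge0.
have rho1 : rho <= r1.
  have -> : r1 = (r1 `^ p) `^ p^-1 by rewrite -powRrM mulfV ?gt_eqF// powRr1// ltW.
  by apply: powR_mono; rewrite ?invr_ge0 ?(ltW p0)//; exact/ltW/dP.
have := rho1; rewrite le_min => /andP[rle1 rlee].
have G : ugrp X (incr h s t) by exact: incr_ugrp.
have -> : h t - h s = h s * (incr h s t - 1).
  by rewrite mulrBr mulr1 /incr mulVKr// ugrp_unit.
have h1 : `|incr h s t - 1| <= n.+1%:R * C * rho.
  rewrite gpart_norm; apply: (@le_trans _ _ (\sum_(k < n.+1) C * rho)); last first.
    by rewrite sumr_const card_ord -[leLHS]mulr_natl mulrA.
  apply: ler_sum => -[[|k] /= kn] _.
    by rewrite linearB /= ((ugrpP _).1 G) ((ugrpP _).1 (ugrp1 X)) subrr normr0 mulr_ge0.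
  rewrite linearB /= gpart1// subr0; apply: (le_trans (level_le hb s0 st tT _)) => //.
  by rewrite ler_wpM2l// -/rho -[leRHS]expr1 ler_wiXn2l.
apply: (le_lt_trans (banach_normM _ _)).
apply: (@le_lt_trans _ _ (B * (n.+1%:R * C * rho))).
  by apply: ler_pM => //; exact: (norm_level_le p1 C0 v_homo hb).
apply: (@le_lt_trans _ _ (c * (e / (c + 1)))).
  by rewrite mulrA ler_wpM2l.
by rewrite mulrCA -[ltRHS]mulr1 ltr_pM2l// ltr_pdivrMr ?mul1r ?ltrDl// ltr_wpDl.
Qed.

(** Homogeneous bounds with a continuous control make the path continuous. *)
Lemma level_continuous : {within `[0, T], continuous h}.
Proof.
apply/subspace_continuousP => t; rewrite /= in_itv /= => /andP[t0 tT].
apply/cvgrPdist_lt => e e0; have [d d0 dP] := level_unif e0.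
have near_t : \forall s \near t, `|t - s| < d by apply/nbhs_ballP; exists d.
suff : \forall s \near t, `[0, T]%classic s -> `|h t - h s| < e by [].
apply: filterS near_t => s ts; rewrite /= in_itv /= => /andP[s0 sT].
move: ts; have [st|ts] := leP s t; rewrite ltr_norml => /andP[h1 h2].
  exact: dP.
by rewrite distrC; apply: dP => //; [exact: ltW|lra].
Qed.

End PathBounds.

Section Lifts.
Context {R : realType} {V : completeNormedModType R} (W : tensor_powers V).
Context {S : eqType} (deg : S -> nat) (F : forall n, triple W deg n).
Context (Fc : consistent F) (N n : nat) (N1 : (1 <= N)%N) (Nn : (N <= n)%N).
Context (p : R) (p1 : 1 <= p) (pN : p < N.+1%:R).
Local Notation X := (F n).
Local Notation Y := (F N).
Let p0 : 0 < p := lt_le_trans ltr01 p1.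

(** [h] is a path of finite [p]-variation above [g], issued from [1]. *)
Definition lift_of (T : R) (g : R -> Y) (h : R -> X) : Prop :=
  [/\ cpvar_path p T h, h 0 = 1 &
      forall t, 0 <= t <= T -> trunc Y (h t) = incr g 0 t].

Section OneLift.
Context (T : R) (g : R -> Y) (h : R -> X).
Hypothesis T0 : 0 <= T.
Hypothesis gG : forall t, 0 <= t -> t <= T -> ugrp Y (g t).

Lemma incr_base s t : 0 <= s -> s <= T ->
  incr (incr g 0) s t = incr g s t.
Proof.
move=> s0 sT; have us := ugrp_unit (gG s0 sT); have u0 := ugrp_unit (gG (lexx 0) T0).
have g0V : (g 0)^-1 \is a GRing.unit by rewrite unitrV.
by rewrite /incr invrM// invrK -mulrA mulVKr.
Qed.

Lemma lift_incr s t : (forall t, 0 <= t -> t <= T -> ugrp X (h t)) ->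
  (forall t, 0 <= t -> t <= T -> trunc Y (h t) = incr g 0 t) ->
  0 <= s -> s <= T -> 0 <= t -> t <= T -> trunc Y (incr h s t) = incr g s t.
Proof.
move=> hG hg s0 sT t0 tT; rewrite (trunc_incr Fc N1 Nn _ (hG s s0 sT)) -incr_base//.
by rewrite /incr -/(incr g 0 s) -/(incr g 0 t) !hg.
Qed.

Hypothesis hl : lift_of T g h.

(** Products of elements of [ugrp X] above the increments of [g], of
    comparable size, converge to the lift. *)
Lemma lift_approx c e : 0 < e -> exists2 d, 0 < d &
  forall (tau : nat -> R) (l : nat) (a : nat -> X),
    {homo tau : i j / (i <= j)%N >-> i <= j} -> tau 0%N = 0 -> tau l <= T ->
    (forall i, (i < l)%N -> tau i.+1 - tau i < d) ->
    (forall i, (i < l)%N -> trunc Y (a i) = incr g (tau i) (tau i.+1) /\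
       hnorm (a i) <= c * hnorm (incr g (tau i) (tau i.+1))) ->
    `|\prod_(0 <= i < l) a i - h (tau l)| < e.
Proof.
move=> e0; have [hp h0 hg] := hl.
have hG t : 0 <= t -> t <= T -> ugrp X (h t) by exact: (path_ugrp hp).
have {}hg t : 0 <= t -> t <= T -> trunc Y (h t) = incr g 0 t.
  by move=> t0 tT; apply: hg; rewrite t0.
pose c' := Num.max 1 c; have c'1 : 1 <= c' by rewrite le_max lexx.
have c'0 : 0 <= c' by exact: le_trans c'1.
pose C := (size (symb X))%:R * c' ^+ n.
have CX : (size (symb X))%:R <= C by rewrite ler_peMr// exprn_ege1.
have C0 : 0 <= C by exact: le_trans CX.
have vh := pcontrol_mono p1 T0 hp; have vs := pcontrol_unif p1 T0 hp.
have hb := cpvar_level_additive p1 T0 hp h0 CX.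
have [d d0 dP] := product_approx p1 T0 C0 vh hb vs pN e0.
exists d => // tau l a tm t00 tl mesh aP; apply: dP => // i k il.
  have tle j : (j <= l)%N -> tau j <= T by move=> jl; rewrite (le_trans _ tl)// tm.
  have tge j : 0 <= tau j by rewrite -t00 tm.
  move=> kN _; apply: (trunc_gpart Fc N1 Nn kN).
  by rewrite (aP i il).1 (lift_incr hG hg)// ?tle// ltnW.
have tle j : (j <= l)%N -> tau j <= T by move=> jl; rewrite (le_trans _ tl)// tm.
have tge j : 0 <= tau j by rewrite -t00 tm.
have ti := tle i (ltnW il); have tii := tle i.+1 il; have tt := tm _ _ (leqnSn i).
case/andP => Nk kn; have k0 : (0 < k)%N by exact: leq_ltn_trans Nk.
apply: (le_trans (gpart_le_hnorm _ _)); first by rewrite k0.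
rewrite /C -mulrA ler_wpM2l//.
set rho := _ `^ _; have rho0 : 0 <= rho by exact: powR_ge0.
have step : hnorm (a i) <= c' * rho.
  apply: (le_trans (aP i il).2); apply: (@le_trans _ _ (c' * hnorm (incr g (tau i) (tau i.+1)))).
    by rewrite ler_wpM2r ?hnorm_ge0// le_max lexx orbT.
  rewrite ler_wpM2l//; rewrite -(lift_incr hG hg)//.
  apply: (le_trans (hnorm_trunc Fc N1 Nn _)).
  apply: (le_trans (hnorm_le_pcontrol p1 T0 hp _ _ _)) => //.
  have /andP[w0 w1] := pcontrol_additive p1 T0 hp (tge i) tt tii.
  by apply: powR_mono => //; rewrite invr_ge0 ltW.
apply: (@le_trans _ _ ((c' * rho) ^+ k)).
  by rewrite lerXn2r ?nnegrE ?hnorm_ge0// mulr_ge0.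
by rewrite exprMn ler_wpM2r ?exprn_ge0// ler_weXn2l.
Qed.

End OneLift.

(** Equidistant partitions of [0, t] have arbitrarily small mesh. *)
Lemma fine_grid (T t d : R) : 0 <= t -> t <= T -> 0 < d ->
  exists tau l, [/\ {homo tau : i j / (i <= j)%N >-> i <= j}, tau 0%N = 0,
    tau l = t & forall i, (i < l)%N -> tau i.+1 - tau i < d].
Proof.
move=> t0 tT d0; pose l := (Num.truncn (t / d)).+1.
have l0 : 0 < l%:R :> R by rewrite ltr0n.
have td : t / l%:R < d.
  rewrite ltr_pdivrMr// mulrC -ltr_pdivrMr//.
  by have /truncn_itv/andP[] : 0 <= t / d by rewrite divr_ge0// ltW.
exists (fun i => t / l%:R * i%:R), l; split.
- by move=> i j ij; rewrite ler_wpM2l ?ler_nat// divr_ge0// ltW.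
- by rewrite mulr0.
- by rewrite divfK// gt_eqF.
- by move=> i _; rewrite -mulrBr -natrB// subSnn mulr1.
Qed.

(** Two lifts are limits of the same products. *)
Lemma lift_unique T (g : R -> Y) (h h' : R -> X) : 0 <= T ->
  (forall t, 0 <= t -> t <= T -> ugrp Y (g t)) ->
  lift_of T g h -> lift_of T g h' -> forall t, 0 <= t -> t <= T -> h t = h' t.
Proof.
move=> T0 gG hl hl' t t0 tT; apply/eqP; rewrite -subr_eq0 -normr_le0.
apply/ler_addgt0Pr => e e0; rewrite add0r; have e2 : 0 < e / 2 by rewrite divr_gt0.
have [d d0 dP] := lift_approx T0 gG hl 1 e2.
have [d' d'0 d'P] := lift_approx T0 gG hl' 1 e2.
have dd : 0 < Num.min d d' by rewrite lt_min d0.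
have [tau [l [tm t00 tl mesh]]] := fine_grid t0 tT dd.
have aP i : (i < l)%N ->
    trunc Y (tembed n (incr g (tau i) (tau i.+1))) = incr g (tau i) (tau i.+1) /\
    hnorm (tembed n (incr g (tau i) (tau i.+1))) <= 1 * hnorm (incr g (tau i) (tau i.+1)).
  by move=> _; rewrite mul1r (tembedK Fc N1 Nn); split => //; exact: hnorm_tembed.
have tT' : tau l <= T by rewrite tl.
have := dP tau l _ tm t00 tT' _ aP; have := d'P tau l _ tm t00 tT' _ aP.
rewrite tl; set A := \prod_(_ <= _ < _) _ => h1 h2.
have m1 i : (i < l)%N -> tau i.+1 - tau i < d by move=> /mesh; rewrite lt_min => /andP[].
have m2 i : (i < l)%N -> tau i.+1 - tau i < d' by move=> /mesh; rewrite lt_min => /andP[].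
have {}h1 := h1 m2; have {}h2 := h2 m1.
have -> : h t - h' t = (A - h' t) - (A - h t) by zmod.
have := ler_normB (A - h' t) (A - h t); lra.
Qed.

(** Existence, with a bound of the increments by the control of [g]. *)
Lemma lift_exists : exists2 K, 0 <= K & forall T (g : R -> Y), 0 <= T ->
  cpvar_path p T g -> exists2 h : R -> X, lift_of T g h &
    forall s t, 0 <= s -> s <= t -> t <= T ->
      (pvar p h s t <= (K * pcontrol p g s t `^ p^-1)%:E)%E.
Proof.
pose C0 : R := (size (symb Y))%:R; have C00 : 0 <= C0 by [].
have NN : (N <= n <= n)%N by rewrite Nn leqnn.
have [C C0C ext] := level_extend X p1 NN pN C00.
have Cge0 : 0 <= C by exact: le_trans C0C.
have [K K0 HK] := hnorm_le X Cge0.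
exists K => // T g T0 gp.
have gG t : 0 <= t -> t <= T -> ugrp Y (g t) by exact: (path_ugrp gp).
pose x t : X := tembed n (incr g 0 t).
have xg t : trunc Y (x t) = incr g 0 t by exact: tembedK.
have fc := fine_pcontrol p1 T0 gp.
have xG t : 0 <= t -> t <= T -> ugrp X (x t).
  by move=> t0 tT; apply: ugrp_tembed => //; apply: incr_ugrp; exact: gG.
have xb : level_bound p T (pcontrol p g) N C0 x.
  split => //; first by rewrite /x (incr_id gp)// tembed1.
  move=> s t k s0 st tT kN; have t0 := le_trans s0 st; have sT := le_trans st tT.
  rewrite -(norm_gpart_trunc Fc N1 Nn) ?(andP kN).2//.
  rewrite (lift_incr T0 gG xG)//.
  apply: (le_trans (gpart_le_hnorm _ kN)); rewrite ler_wpM2l//.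
  rewrite lerXn2r ?nnegrE ?hnorm_ge0 ?powR_ge0//.
  exact: (hnorm_le_pcontrol p1 T0 gp).
have [h hb hx] := ext T (pcontrol p g) x T0 fc xb.
have [w0 wD _] := fc.
have hK s t : 0 <= s -> s <= t -> t <= T ->
    hnorm (incr h s t) <= K * pcontrol p g s t `^ p^-1.
  move=> s0 st tT; apply: HK; first exact: powR_ge0.
  by move=> k kn; exact: (level_le hb).
have hpv s t : 0 <= s -> s <= t -> t <= T ->
    (pvar p h s t <= (K * pcontrol p g s t `^ p^-1)%:E)%E.
  exact: (pvar_le p1 K0 w0 wD hK).
have hc : {within `[0, T], continuous h}.
  have hb' : level_bound p T (fun s t => pcontrol p g 0 t - pcontrol p g 0 s) n C h.
    apply: (level_weaken p1 (lexx C) Cge0) hb => s t s0 st tT.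
    exact: (pcontrol_additive p1 T0 gp).
  exact: (level_continuous p1 T0 Cge0 (pcontrol_mono p1 T0 gp)
    (pcontrol_unif p1 T0 gp) hb').
have hp : cpvar_path p T h.
  split; [by move=> t /andP[]; exact: (level_ugrp hb)|exact: hc|].
  by apply: (le_lt_trans (hpv 0 T (lexx 0) T0 (lexx T))); rewrite ltry.
exists h; last exact: hpv.
split; [exact: hp|exact: (level_start hb)|move=> t /andP[t0 tT]].
rewrite -xg; apply: (trunc_eq Fc N1 Nn) => k kN; exact: hx.
Qed.

(** Lifting of group elements with control of the size. *)
Lemma tgrp_lift : (forall m, (1 <= m)%N -> exists2 Cm : R, 0 < Cm &
     forall a, tgrp (F m) a -> exists a' : F m.+1,
       [/\ tgrp (F m.+1) a', trunc (F m) a' = a & hnorm a' <= Cm * hnorm a]) ->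
  exists2 c : R, 0 < c & forall a, tgrp Y a -> exists a' : X,
    [/\ tgrp X a', trunc Y a' = a & hnorm a' <= c * hnorm a].
Proof.
move=> H; elim: n Nn => [|m IH] Nm.
  by move: N1 Nm; case: N.
move: Nm; rewrite leq_eqVlt => /orP[/eqP Nm|Nm].
  rewrite -Nm; exists 1 => // a aG; exists a; split => //; last by rewrite mul1r.
  by rewrite (truncE Fc N1 (leqnn N)) [RHS]gpart_sum.
have [c c0 cP] := IH Nm; have m1 := leq_trans N1 (Nm : (N <= m)%N).
have [c' c'0 c'P] := H m m1.
exists (c' * c); first by rewrite mulr_gt0.
move=> a aG; have [b [bG ba bc]] := cP a aG; have [b' [b'G b'b b'c]] := c'P b bG.
exists b'; split => //; first by rewrite -ba -b'b (trunc_trunc Fc)// leqnSn.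
by apply: (le_trans b'c); rewrite -mulrA ler_wpM2l// ltW.
Qed.

Lemma incr_tgrp (g : R -> Y) s t : tgrp Y (g s) -> tgrp Y (g t) -> tgrp Y (incr g s t).
Proof.
move=> gs gt; apply: (topgrpM (tgrp_group Y)) => //.
exact: (topgrpV (tgrp_group Y)).
Qed.

(** A lift is the limit of products of elements of [tgrp X] above the increments
    of [g]. *)
Lemma lift_tgrp T (g : R -> Y) (h : R -> X) : 0 <= T -> lift_of T g h ->
  (forall t, 0 <= t -> t <= T -> tgrp Y (g t)) ->
  (exists2 c : R, 0 < c & forall a, tgrp Y a -> exists a' : X,
    [/\ tgrp X a', trunc Y a' = a & hnorm a' <= c * hnorm a]) ->
  forall t, 0 <= t -> t <= T -> tgrp X (h t).
Proof.
move=> T0 hl gT [c c0 cP] t t0 tT.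
have gG u : 0 <= u -> u <= T -> ugrp Y (g u).
  by move=> u0 uT; apply: tgrp_proj0; exact: gT.
have cP' (a : Y) : exists a' : X, tgrp Y a ->
    [/\ tgrp X a', trunc Y a' = a & hnorm a' <= c * hnorm a].
  have [aG|aG] := pselect (tgrp Y a); last by exists 0.
  by have [a' H] := cP a aG; exists a'.
have [f fP] := choice cP'.
apply: tgrp_closed => B /nbhs_ballP [e e0 eB].
have [d d0 dP] := lift_approx T0 gG hl c e0.
have [tau [l [tm t00 tl mesh]]] := fine_grid t0 tT d0.
have tT' : tau l <= T by rewrite tl.
have tle j : (j <= l)%N -> tau j <= T by move=> jl; rewrite (le_trans _ tT')// tm.
have tge j : 0 <= tau j by rewrite -t00 tm.
have iG i : (i < l)%N -> tgrp Y (incr g (tau i) (tau i.+1)).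
  move=> il; exact: (incr_tgrp (gT _ (tge i) (tle i (ltnW il)))
    (gT _ (tge i.+1) (tle i.+1 il))).
pose a i := f (incr g (tau i) (tau i.+1)).
exists (\prod_(0 <= i < l) a i); split.
  rewrite big_nat_cond; apply: (big_ind (tgrp X)).
  - exact: (topgrp1 (tgrp_group X)).
  - exact: (topgrpM (tgrp_group X)).
  - by move=> i /andP[/= il _]; have [] := fP _ (iG i il).
apply: eB; rewrite -ball_normE /= distrC -tl; apply: dP => // i il.
by have [] := fP _ (iG i il).
Qed.

End Lifts.

(** * The cocyclic one-form of a path *)

Section OpNorm.
Context {R : realType} (A B : normedModType R).

Lemma opnorm_le (f : A -> B) M : (forall v, `|v| <= 1 -> `|f v| <= M) ->
  opnorm f <= M.
Proof.
move=> H; apply: ge_sup; first by exists `|f 0|, 0 => //=; rewrite normr0.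
by move=> _ [v /= v1 <-]; exact: H.
Qed.

Lemma opnorm_ge0 (f : A -> B) M : (forall v, `|v| <= 1 -> `|f v| <= M) ->
  0 <= opnorm f.
Proof.
move=> H; apply: (@le_trans _ _ `|f 0|) => //; apply: ub_le_sup.
  by exists M => _ [v /= v1 <-]; exact: H.
by exists 0 => //=; rewrite normr0.
Qed.

End OpNorm.

Section OneForm.
Context {R : realType} {V : completeNormedModType R} (W : tensor_powers V).
Context {S : eqType} (deg : S -> nat) (F : forall n, triple W deg n).
Context (Fc : consistent F) (N n : nat) (N1 : (1 <= N)%N) (Nn : (N <= n)%N).
Local Notation X := (F n).
Local Notation Y := (F N).

(** The linear maps of which the one-form consists. *)
Definition embed_mul (c : X) (d : Y) (v : Y) : X := c * tembed n (d * v).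

Lemma embed_mul_is_linear c d : linear (embed_mul c d).
Proof.
move=> k u v; rewrite /embed_mul mulrDr -scalerAr linearP mulrDr.
by rewrite -scalerAr.
Qed.

HB.instance Definition _ c d :=
  GRing.isLinear.Build R Y X _ (embed_mul c d) (embed_mul_is_linear c d).

Lemma norm_embed_mul c d v : `|embed_mul c d v| <= `|c| * `|d| * `|v|.
Proof.
apply: (le_trans (banach_normM _ _)); rewrite -mulrA ler_wpM2l//.
by apply: (le_trans (norm_tembed Fc N1 Nn _)); exact: banach_normM.
Qed.

Lemma embed_mul_continuous c d : continuous (embed_mul c d).
Proof.
apply: bounded_linear_continuous; apply/linear_boundedP.
exists (`|c| * `|d|); split; first exact: num_real.
move=> r rlt v; apply: (le_trans (norm_embed_mul _ _ _)).
by rewrite ler_wpM2r// ltW.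
Qed.

Definition embed_mul_clin c d : clin Y X := Clin (@embed_mul_continuous c d).

Lemma embed_mul_opnorm_cvg (I : Type) (G : set_system I) (FG : Filter G)
    (c : I -> X) (d : I -> Y) (c0 : X) (d0 : Y) :
  c @ G --> c0 -> d @ G --> d0 ->
  (fun i => opnorm (embed_mul_clin (c i) (d i) \- embed_mul_clin c0 d0)) @ G
    --> (0 : R).
Proof.
move=> cc dd.
have bd i v : `|v| <= 1 -> `|(embed_mul_clin (c i) (d i) \- embed_mul_clin c0 d0) v|
    <= `|c i - c0| * `|d i| + `|c0| * `|d i - d0|.
  move=> v1 /=.
  have -> : embed_mul (c i) (d i) v - embed_mul c0 d0 v =
      embed_mul (c i - c0) (d i) v + embed_mul c0 (d i - d0) v.
    by rewrite /embed_mul !mulrBl linearB /= mulrBr; zmod.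
  apply: (le_trans (ler_normD _ _)); apply: lerD.
    apply: (le_trans (norm_embed_mul _ _ _)).
    by rewrite -[leRHS]mulr1 ler_wpM2l// mulr_ge0.
  apply: (le_trans (norm_embed_mul _ _ _)).
  by rewrite -[leRHS]mulr1 ler_wpM2l// mulr_ge0.
have e0 : (fun i => `|c i - c0| * `|d i| + `|c0| * `|d i - d0|) @ G --> (0 : R).
  have n1 : (fun i => `|c i - c0|) @ G --> (0 : R).
    rewrite -[X in _ --> X](@normr0 _ X) -(subrr c0).
    by apply: cvg_norm; apply: cvgB => //; exact: cvg_cst.
  have n2 : (fun i => `|d i - d0|) @ G --> (0 : R).
    rewrite -[X in _ --> X](@normr0 _ Y) -(subrr d0).
    by apply: cvg_norm; apply: cvgB => //; exact: cvg_cst.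
  have n3 : (fun i => `|d i|) @ G --> `|d0| by exact: cvg_norm.
  have h := cvgD (cvgM n1 n3) (cvgM (cvg_cst `|c0|) n2).
  by rewrite mul0r mulr0 addr0 in h; exact: h.
apply: (@squeeze_cvgr _ _ _ _ (fun=> 0) (fun i => `|c i - c0| * `|d i| + `|c0| * `|d i - d0|)) => //.
  apply: nearW => i; rewrite (opnorm_ge0 (bd i)) /=.
  exact: (opnorm_le (bd i)).
exact: cvg_cst.
Qed.

Context (T : R) (g : R -> Y).

(** The one-form [beta_s(a, b) = e(g_s^-1 a)^-1 e(g_s^-1 a b)], where [e] is the
    section [tembed] of the truncation. Time is clipped to [0, T], and inverses are
    written as polynomials, so that it is defined and continuous everywhere. *)
Definition path_form (s : R) (a : Y) : clin Y X :=
  embed_mul_clin (tinv (tembed n (tinv (g (clip T s)) * a))) (tinv (g (clip T s)) * a).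

Hypothesis T0 : 0 <= T.
Hypothesis gG : forall t, 0 <= t -> t <= T -> ugrp Y (g t).
Hypothesis gc : {within `[0, T], continuous g}.

Let gcG s : ugrp Y (g (clip T s)).
Proof. by apply: gG; [exact: clip_ge0|exact: clip_le]. Qed.

Lemma tembed_cvg (I : Type) (G : set_system I) (FG : Filter G) (d : I -> Y) (d0 : Y) :
  d @ G --> d0 -> (fun i => tembed n (d i)) @ G --> tembed n d0.
Proof.
move=> /cvgrPdist_lt h; apply/cvgrPdist_lt => e /h; apply: filterS => i.
apply: le_lt_trans; rewrite -linearB; exact: norm_tembed.
Qed.

Lemma path_form_cocyclic s : cocyclic (ugrp Y) (ugrp X) (path_form s).
Proof.
have sG a : ugrp Y a -> ugrp Y (tinv (g (clip T s)) * a).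
  by move=> aG; apply: ugrpM => //; exact: ugrp_tinv.
split.
- move=> a aG.
  have dc : (fun b => tinv (g (clip T s)) * b) @ within (ugrp Y) (nbhs a) -->
      tinv (g (clip T s)) * a.
    by apply: banach_cvgM; [exact: cvg_cst|exact: cvg_within].
  apply: embed_mul_opnorm_cvg => //.
  by apply: tinv_cvg; exact: tembed_cvg.
- move=> a b aG bG; rewrite /path_form /= /embed_mul; apply: ugrpM.
    by apply: ugrp_tinv; apply: (ugrp_tembed Fc N1 Nn); exact: sG.
  by apply: (ugrp_tembed Fc N1 Nn); apply: ugrpM => //; exact: sG.
move=> a b c aG bG cG; rewrite /path_form /= /embed_mul.
set d := tinv (g _) * a; have dG : ugrp Y d by exact: sG.
rewrite !mulrA -/d; rewrite -(mulrA (tinv (tembed n d))) mul_tinv ?mulr1//.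
by apply: (ugrp_tembed Fc N1 Nn); exact: ugrpM.
Qed.

Lemma path_form_cocyclic_path : cocyclic_path T (ugrp Y) (ugrp X) path_form.
Proof.
split; first by move=> t _; exact: path_form_cocyclic.
move=> a aG t _.
have gt : (fun u => g (clip T u)) @ within `[0, T]%classic (nbhs t) --> g (clip T t).
  by apply: cvg_trans (within_clip T0 gc (t := t)); apply: cvg_app; exact: cvg_within.
have dc : (fun u => tinv (g (clip T u)) * a) @ within `[0, T]%classic (nbhs t) -->
    tinv (g (clip T t)) * a.
  by apply: banach_cvgM; [exact: tinv_cvg|exact: cvg_cst].
apply: embed_mul_opnorm_cvg => //.
by apply: tinv_cvg; exact: tembed_cvg.
Qed.

(** Along the path, the one-form is the section of the truncation. *)
Lemma path_formE s b : 0 <= s -> s <= T -> path_form s (g s) b = tembed n b.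
Proof.
move=> s0 sT; rewrite /path_form /= /embed_mul (clip_id s0 sT) (tinv_mul (gG s0 sT)).
rewrite (tembed1 Fc N1 Nn) /tinv subrr mul1r big_ord_recl expr0 big1 ?addr0 ?mul1r// => i _.
by rewrite exprS mul0r.
Qed.

(** The defect of multiplicativity of the section controls the variation of
    the one-form in time. *)
Lemma path_form_diff s u b : 0 <= s -> s <= u -> u <= T ->
  path_form u (g u) b - path_form s (g u) b =
  tinv (tembed n (incr g s u)) *
    (tembed n (incr g s u) * tembed n b - tembed n (incr g s u * b)).
Proof.
move=> s0 su uT; have u0 := le_trans s0 su; have sT := le_trans su uT.
rewrite path_formE// /path_form /= /embed_mul (clip_id s0 sT).
rewrite -(ugrp_invE (gG s0 sT)) -/(incr g s u) mulrBr mulrA tinv_mul ?mul1r//.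
by apply: (ugrp_tembed Fc N1 Nn); apply: incr_ugrp; exact: gG.
Qed.

Lemma one_form_integral (p : R) (h : R -> X) : 1 <= p -> p < N.+1%:R ->
  lift_of p T g h ->
  forall t, 0 <= t -> t <= T -> is_one_form_integral path_form g 0 t (h t).
Proof.
move=> p1 pN hl t t0 tT e e0.
have [d d0 dP] := lift_approx Fc N1 Nn p1 pN T0 gG hl 1 e0.
exists d => // D tD mesh.
pose tau i := nth t (0 :: D) i.
have tl : tau (size D) = t by exact: itv_partition_nth_size.
have nthD i : (size D < i)%N -> tau i = t by move=> Di; rewrite /tau nth_default.
have le_t i : tau i <= t.
  have [iD|Di] := leqP i (size D); first exact: itv_partition_nth_le.
  by rewrite nthD.
have tm : {homo tau : i j / (i <= j)%N >-> i <= j}.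
  apply: homo_leq => // [x y z|i]; first exact: le_trans.
  have [iD|Di] := ltnP i (size D); last by rewrite (nthD i.+1).
  case: tD => /(pathP t) /(_ i iD) lt_i _; exact: ltW lt_i.
have tge i : 0 <= tau i by exact: tm (leq0n i).
have tleT i : tau i <= T by exact: le_trans tT.
rewrite -[in h t]tl /one_form_prod.
rewrite (eq_bigr (fun i => tembed n (incr g (tau i) (tau i.+1)))); last first.
  by move=> i _; rewrite -/(tau i) -/(tau i.+1) path_formE.
apply: (dP tau (size D) _ tm _ (tleT _) mesh) => // i il.
by rewrite (tembedK Fc N1 Nn) mul1r; split => //; exact: hnorm_tembed.
Qed.

End OneForm.

(** * The integrable condition *)

Section Integrable.
Context {R : realType} {V : completeNormedModType R} (W : tensor_powers V).
Context {S : eqType} (deg : S -> nat) (F : forall n, triple W deg n).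
Context (Fc : consistent F) (N n : nat) (N1 : (1 <= N)%N) (Nn : (N <= n)%N).
Context (p : R) (p1 : 1 <= p) (pN : p < N.+1%:R).
Local Notation X := (F n).
Local Notation Y := (F N).
Let p0 : 0 < p := lt_le_trans ltr01 p1.

Lemma gpart_tembed_norm k (a : Y) : (k <= N)%N ->
  `|gpart k (tembed n a : X)| = `|gpart k a|.
Proof. by move=> kN; rewrite -(norm_gpart_trunc Fc N1 Nn)// tembedK. Qed.

(** The section is multiplicative up to degree [N]; above, only the products of
    components of positive degree remain. *)
Lemma tembed_defect C : 0 <= C -> exists2 K, 0 <= K &
  forall (a b : Y) x y r m, 0 <= x -> 0 <= y -> x <= r -> y <= r -> r <= m ->
    1 <= m -> ugrp Y a -> ugrp Y b ->
    (forall k, (0 < k <= N)%N -> `|gpart k a| <= C * x ^+ k) ->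
    (forall k, (0 < k <= N)%N -> `|gpart k b| <= C * y ^+ k) ->
    `|tembed n a * tembed n b - tembed n (a * b) : X| <= K * m ^+ n * r ^+ N.+1.
Proof.
move=> C0; exists (n.+1%:R * (n%:R * C ^+ 2)); first by rewrite !mulr_ge0// exprn_ge0.
move=> a b x y r m x0 y0 xr yr rm m1 aG bG Ha Hb.
have r0 := le_trans x0 xr; have m0 := le_trans ler01 m1.
rewrite gpart_norm.
apply: (@le_trans _ _ (\sum_(k < n.+1) (n%:R * C ^+ 2) * m ^+ n * r ^+ N.+1)); last first.
  by rewrite sumr_const card_ord -[leLHS]mulr_natl !mulrA.
apply: ler_sum => k _; have kn : (k <= n)%N by exact: leq_ord.
rewrite linearB /=; have [kN|Nk] := leqP k N.
  have -> : gpart k (tembed n a * tembed n b : X) = gpart k (tembed n (a * b)).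
    by apply: (trunc_gpart Fc N1 Nn kN); rewrite (trunc_mul Fc N1 Nn) !(tembedK Fc N1 Nn).
  by rewrite subrr normr0 !mulr_ge0// exprn_ge0.
have Nkn : (N < k <= n)%N by rewrite Nk.
have k0 : (0 < k <= n)%N by rewrite kn (leq_ltn_trans _ Nk).
rewrite (gpart_tembed_high Nn _ Nkn) subr0 gpartM_cross//; try exact: (ugrp_tembed Fc N1 Nn).
rewrite !(gpart_tembed_high Nn _ Nkn) !add0r.
have bnd (z : R) (c : Y) : 0 <= z ->
    (forall i, (0 < i <= N)%N -> `|gpart i c| <= C * z ^+ i) ->
    forall i, (0 < i < k)%N -> `|gpart i (tembed n c : X)| <= C * z ^+ i.
  move=> z0 H i /andP[i0 ik]; have [iN|Ni] := leqP i N.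
    by rewrite gpart_tembed_norm// H// i0.
  rewrite gpart_tembed_high ?normr0 ?mulr_ge0 ?exprn_ge0//.
  by rewrite Ni (leq_trans (ltnW ik)).
apply: (le_trans (norm_cross kn C0 x0 y0 xr yr (bnd x a x0 Ha) (bnd y b y0 Hb))).
have C20 : 0 <= C ^+ 2 by exact: exprn_ge0.
have rN0 : 0 <= r ^+ N.+1 by exact: exprn_ge0.
have rm_le : r ^+ (k - N.+1) <= m ^+ n.
  apply: (@le_trans _ _ (m ^+ (k - N.+1))); first by rewrite lerXn2r ?nnegrE.
  by rewrite ler_weXn2l// (leq_trans (leq_subr _ _)).
have -> : r ^+ k = r ^+ (k - N.+1) * r ^+ N.+1 by rewrite -exprD subnK.
rewrite -[leRHS]mulrA; apply: ler_pM.
- by rewrite mulr_ge0.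
- by rewrite mulr_ge0// exprn_ge0.
- by rewrite ler_wpM2r// ler_nat.
- by rewrite ler_wpM2r.
Qed.

Context (T : R) (g : R -> Y) (T0 : 0 <= T) (gp : cpvar_path p T g).

Let v t := pcontrol p g 0 t.
Let gG t : 0 <= t -> t <= T -> ugrp Y (g t).
Proof. exact: (path_ugrp gp). Qed.

Lemma clipped_control_cvg t : v (clip T s) @[s --> t] --> v (clip T t).
Proof.
apply/cvgrPdist_lt => e e0; have [d d0 dP] := pcontrol_unif p1 T0 gp e0.
have near_t : \forall s \near t, `|t - s| < d by apply/nbhs_ballP; exists d.
apply: filterS near_t => s ts; have := le_lt_trans (clip_lip T0 t s) ts.
have c0 := clip_ge0 T; have cT := clip_le T0.
have [st|st] := leP (clip T s) (clip T t); rewrite ltr_norml => /andP[h1 h2].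
  rewrite ger0_norm ?subr_ge0; first exact: dP.
  exact: (pcontrol_mono p1 T0 gp).
rewrite distrC ger0_norm ?subr_ge0; last first.
  by apply: (pcontrol_mono p1 T0 gp) => //; exact: ltW.
by apply: dP => //; [exact: ltW|lra].
Qed.

(** Clipping extends the control of [g] to a continuous function on the whole
    line, so that continuity on the simplex is that of a difference. *)
Lemma additive_is_control L : 0 <= L ->
  is_control T (fun s t => L * (v (clip T t) - v (clip T s))).
Proof.
move=> L0; split.
- apply: continuous_subspaceT => x.
  apply: cvgM; first exact: cvg_cst.
  apply: cvgB.
    exact: (cvg_comp snd (fun s => v (clip T s)) cvg_snd (clipped_control_cvg (t := x.2))).
  exact: (cvg_comp fst (fun s => v (clip T s)) cvg_fst (clipped_control_cvg (t := x.1))).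
- move=> s t /andP[s0 st] tT; have t0 := le_trans s0 st; have sT := le_trans st tT.
  by rewrite mulr_ge0// !clip_id// subr_ge0; exact: (pcontrol_mono p1 T0 gp).
- by move=> t _; rewrite subrr mulr0.
- by move=> s u t _ _; rewrite -mulrDr ler_wpM2l//; lra.
Qed.

Lemma path_form_integrable : integrable_condition T (path_form Fc N1 Nn T g) g.
Proof.
pose C : R := (size (symb Y))%:R; have C0 : 0 <= C by [].
pose y t : Y := incr g 0 t.
have yE s t : 0 <= s -> s <= T -> incr y s t = incr g s t by exact: incr_base.
have vh := pcontrol_mono p1 T0 gp.
have yb : level_bound p T (fun s t => v t - v s) N C y.
  split; [by move=> t t0 tT; apply: incr_ugrp; exact: gG|exact: (incr_id gp)|].
  move=> s t k s0 st tT kN; rewrite yE ?(le_trans st)//.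
  apply: (le_trans (gpart_le_hnorm _ kN)); rewrite ler_wpM2l//.
  rewrite lerXn2r ?nnegrE ?hnorm_ge0 ?powR_ge0//.
  apply: (le_trans (hnorm_le_pcontrol p1 T0 gp s0 st tT)).
  have /andP[w0 w1] := pcontrol_additive p1 T0 gp s0 st tT.
  by apply: powR_mono => //; rewrite invr_ge0 ltW.
pose B := level_norm N p T v C.
have nB s t : 0 <= s -> s <= t -> t <= T -> `|incr g s t| <= B.
  move=> s0 st tT; rewrite -yE ?(le_trans st)//.
  exact: (norm_incr_le p1 C0 vh yb).
have B0 : 0 <= B by exact: (level_norm_ge0 p1 T0 C0 vh yb).
have [kap kap0 kapP] := act_bounded X.
have [K K0 KP] := tembed_defect C0.
pose m := Num.max 1 ((v T - v 0) `^ p^-1).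
have m1 : 1 <= m by rewrite le_max lexx.
pose B' := \sum_(k < n.+1) (1 + B) ^+ k.
have B'0 : 0 <= B' by apply: sumr_ge0 => k _; rewrite exprn_ge0// addr_ge0.
pose L' := kap * (B' * (K * m ^+ n)).
have L'0 : 0 <= L' by rewrite !mulr_ge0// exprn_ge0// (le_trans ler01).
pose th := N.+1%:R / p.
have th1 : 1 < th by rewrite /th ltr_pdivlMr// mul1r.
have th0 : 0 < th by exact: lt_trans th1.
(* the constant enters the control, which is raised to the power [th] *)
pose L := L' `^ th^-1; have L0 : 0 <= L by exact: powR_ge0.
exists (kap * B + 1), th, (fun s t => L * (v (clip T t) - v (clip T s))); split.
- by rewrite ltr_wpDl// mulr_ge0.
- exact: th1.
- exact: additive_is_control.
- move=> sigma sX s t s0 st tT.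
  rewrite path_formE//; last exact: le_trans (ltW st) tT.
  apply: (@le_trans _ _ (kap * B)); last by rewrite lerDl.
  apply: (le_trans (kapP _ sX _)); rewrite ler_wpM2l//.
  apply: (le_trans (norm_tembed Fc N1 Nn _)); apply: nB => //; exact: ltW.
move=> sigma sX s u t s0 su ut tT.
have u0 : 0 <= u by exact: le_trans (ltW su).
have uT : u <= T by exact: le_trans (ltW ut) tT.
have sT : s <= T by exact: le_trans (ltW su) uT.
have t0 : 0 <= t by exact: le_trans (ltW ut).
have st : s <= t by exact: ltW (lt_trans su ut).
rewrite path_form_diff//; last exact: ltW.
apply: (le_trans (kapP _ sX _)).
rewrite !clip_id// powRM ?subr_ge0 ?vh// /L powRK ?gt_eqF// /L'.
have [vsu vut] := (vh s u s0 (ltW su) uT, vh u t u0 (ltW ut) tT).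
rewrite /th -expr_powR ?subr_ge0 ?vh//.
rewrite -[leRHS]mulrA ler_wpM2l// -[leRHS]mulrA.
apply: (le_trans (banach_normM _ _)); apply: ler_pM => //.
  apply: norm_tinv; apply: (le_trans (norm_tembed Fc N1 Nn _)).
  by apply: nB => //; exact: ltW.
have ip : 0 <= p^-1 by rewrite invr_ge0 ltW.
apply: (KP _ _ ((v u - v s) `^ p^-1) ((v t - v u) `^ p^-1)); rewrite ?powR_ge0//.
- by apply: powR_mono; rewrite ?subr_ge0// lerD2r.
- by apply: powR_mono; rewrite ?subr_ge0// lerD2l lerN2.
- rewrite le_max; apply/orP; right; apply: powR_mono; rewrite ?subr_ge0 ?vh//.
  exact: lerB (vh t T t0 tT (lexx T)) (vh 0 s (lexx 0) s0 sT).
- by apply: incr_ugrp; exact: gG.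
- by apply: incr_ugrp; exact: gG.
- by move=> k kN; rewrite -yE//; exact: (level_le yb s0 (ltW su) uT kN).
- by move=> k kN; rewrite -yE//; exact: (level_le yb u0 (ltW ut) tT kN).
Qed.

End Integrable.

Theorem theorem22 (R : realType) (V : completeNormedModType R)
    (W : tensor_powers V) (S : eqType) (deg : S -> nat)
    (F : forall n, triple W deg n) (F_consistent : consistent F)
    (p : R) (p_ge1 : 1 <= p) (n : nat) (n_gt : (Num.truncn p + 1 <= n)%N) :
  exists C : R,
  forall (T : R) (g : R -> F (Num.truncn p)), 0 <= T ->
  cpvar_path p T g ->
  let is_lift (h : R -> F n) :=
    [/\ cpvar_path p T h, h 0 = 1 &
        forall t, 0 <= t <= T -> trunc (F (Num.truncn p)) (h t) = incr g 0 t] in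
  exists gn : R -> F n,
  [/\ is_lift gn,
      forall h, is_lift h -> forall t, 0 <= t <= T -> h t = gn t,
      exists beta : R -> F (Num.truncn p) -> clin (F (Num.truncn p)) (F n),
        [/\ cocyclic_path T (ugrp (F (Num.truncn p))) (ugrp (F n)) beta,
            integrable_condition T beta g &
            forall t, 0 <= t <= T -> is_one_form_integral beta g 0 t (gn t)],
      forall s t, 0 <= s <= t -> t <= T ->
        (pvar p gn s t <= C%:E * pvar p g s t)%E &
      (forall t, 0 <= t <= T -> tgrp (F (Num.truncn p)) (g t)) ->
      (forall m, (1 <= m)%N -> exists2 Cm : R, 0 < Cm &
         forall a, tgrp (F m) a -> exists a' : F m.+1,
           [/\ tgrp (F m.+1) a', trunc (F m) a' = a &
               hnorm a' <= Cm * hnorm a]) ->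
      forall t, 0 <= t <= T -> tgrp (F n) (gn t)].
Proof.
have p0 : 0 <= p by exact: le_trans p_ge1.
have /andP[_ pN] := truncn_itv p0.
have N1 : (1 <= Num.truncn p)%N by rewrite truncn_gt0.
set N := Num.truncn p in n_gt pN N1 *.
have Nn : (N <= n)%N by rewrite (leq_trans _ n_gt)// leq_addr.
have [K K0 KP] := lift_exists F_consistent N1 Nn p_ge1 pN.
exists K => T g T0 gp is_lift.
have gG t : 0 <= t -> t <= T -> ugrp (F N) (g t) by exact: (path_ugrp gp).
have [h hl hpv] := KP T g T0 gp.
exists h; split.
- exact: hl.
- move=> h' hl' t /andP[t0 tT].
  exact: (lift_unique F_consistent N1 Nn p_ge1 pN T0 gG hl' hl t0 tT).
- exists (path_form F_consistent N1 Nn T g); split.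
  + have [_ gc _] := gp.
    exact: (path_form_cocyclic_path F_consistent N1 Nn T0 gG gc).
  + exact: (path_form_integrable F_consistent N1 Nn p_ge1 pN T0 gp).
  + move=> t /andP[t0 tT]; exact: (one_form_integral _ _ _ T0 gG p_ge1 pN hl).
- move=> s t /andP[s0 st] tT; apply: (le_trans (hpv s t s0 st tT)).
  by rewrite EFinM lee_wpmul2l ?lee_fin// (pcontrol_le_pvar p_ge1 T0 gp).
move=> gT H t /andP[t0 tT].
have gT' u : 0 <= u -> u <= T -> tgrp (F N) (g u) by move=> u0 uT; apply: gT; rewrite u0.
apply: (lift_tgrp F_consistent N1 Nn p_ge1 pN T0 hl gT' _ t0 tT).
exact: tgrp_lift.
Qed.
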